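(* Let $\Phi$ be the property of being regular. Then for all integers $n\ge3$, $$\tau_\Phi(n,0)=\max\{1,n-3\}.$$ Further, up to isomorphism, the nonlinear regular betweenness structures of minimum co-size (that is, those regular betweenness structures of order $n\geq 3$ whose co-size equals $\tau_\Phi(n,0)$) are the following: - $\mathcal{Q}_n^3$ for $n\ge4$; - $\mathcal{R}_{n,i}^3$ for $n\ge4$, $i\in I_n^3$; - $\mathcal{S}_n^3$ for $n\ge4$; - $\mathcal{B}(K_3)$, where $K_3$ is the complete graph on three vertices with unit edge weights.
   Context: A betweenness structure is a pair $\mathcal{B}=(X,\beta)$ where $X$ is a nonempty finite set and $\beta\subseteq X^3$; write $(x\ y\ z)$ for $(x,y,z)\in\beta$. All betweenness structures are assumed to be almost-metrizable, i.e. for all $x,y,z,w\in X$: (P1) $(x\ x\ z)$; (P2) $(x\ y\ z)\Rightarrow(z\ y\ x)$; (P3) $(x\ y\ z)\wedge(y\ x\ z)\Rightarrow x=y$; (P4) $(x\ y\ z)\wedge(x\ w\ y)\Rightarrow(x\ w\ z)\wedge(w\ y\ z)$. The order of $\mathcal{B}$ is $|X|$. A set of three distinct points is collinear if some ordering of it is in $\beta$; otherwise it is a triangle. The co-size of $\mathcal{B}$ is its number of triangles; $\mathcal{B}$ is linear if its co-size is $0$, and nonlinear otherwise. The substructure induced by nonempty $Y\subseteq X$ is $(Y,\beta\cap Y^3)$. Isomorphisms are bijections of ground sets preserving betweenness in both directions. Graphs are connected with positive real edge weights (weight $1$ unless specified). For a graph $W$ with shortest-path metric $d_W$ (path length is the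 sum of edge weights), the betweenness structure $\mathcal{B}(W)$ induced by $W$ lives on the vertex set and has $(x\ y\ z)$ iff $d_W(x,z)=d_W(x,y)+d_W(y,z)$. A betweenness structure is regular if no four of its points induce a substructure isomorphic to $\mathcal{B}(C_4)$, where $C_4$ is the $4$-cycle with unit weights. For a hereditary property $\Phi$ of betweenness structures, $B_\Phi(n,m)$ is the set of betweenness structures of order $n$ and co-size $m$ that satisfy $\Phi$, and $\tau_\Phi(n,k)=\min\{m>k:B_\Phi(n,m)\ne\emptyset\}$. Let $I_n^3=\{i\in\mathbb{N}:1\le i\le n-3\}$. The following graphs have vertex set $\{x_1,\dots,x_{n-2},y,z\}$ and are obtained from the path $P=x_1x_2\ldots x_{n-2}$: - $Q_n^3$ ($n\ge4$): add edges $\{y,x_1\}$ and $\{z,x_1\}$; - $R_{n,i}^3$ ($n\ge4$, $i\in I_n^3$): delete edge $\{x_i,x_{i+1}\}$, add edges $\{y,x_i\},\{z,x_i\}$, and add edges $\{y,x_{i+1}\},\{z,x_{i+1}\}$ of weight $2$; - $S_n^3$ ($n\ge4$): add edge $\{x_1,y\}$, and add edge $\{x_{n-2},z\}$ of weight $2$ and edge $\{y,z\}$ of weight $n-2$. $\mathcal{Q}_n^3,\mathcal{R}_{n,i}^3,\mathcal{S}_n^3$ are the betweenness structures induced by $Q_n^3,R_{n,i}^3,S_n^3$. *)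

(* Defs.v *)
From mathcomp Require Import all_boot all_order all_algebra.
From mathcomp Require Import boolp classical_sets reals.
From mathcomp Require Import zify lra.

Set Implicit Arguments.
Unset Strict Implicit.
Unset Printing Implicit Defensive.

Import Order.TTheory GRing.Theory Num.Theory.
Local Open Scope ring_scope.

Record betweenness := Betweenness {
  point :> finType;
  betw : point -> point -> point -> bool;
  point_neq0 : (0 < #|point|)%N;
  betw_refl : forall x z, betw x x z;
  betw_sym : forall x y z, betw x y z -> betw z y x;
  betw_anti : forall x y z, betw x y z -> betw y x z -> x = y;
  betw_trans : forall x y z w,
    betw x y z -> betw x w y -> betw x w z /\ betw w y z }.

Definition iso (A B : betweenness) : Prop :=
  exists f : A -> B,
    bijective f /\ forall x y z, betw (f x) (f y) (f z) = betw x y z.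

Section Substructure.
Variables (B : betweenness) (Y : {set B}) (Y_neq0 : (0 < #|Y|)%N).

Let T : finType := {x : B | x \in Y}.
Let sbetw (x y z : T) := betw (val x) (val y) (val z).

Fact sub_neq0 : (0 < #|T|)%N.
Proof. by rewrite card_sig. Qed.

Fact sub_refl x z : sbetw x x z.
Proof. exact: betw_refl. Qed.

Fact sub_sym x y z : sbetw x y z -> sbetw z y x.
Proof. exact: betw_sym. Qed.

Fact sub_anti x y z : sbetw x y z -> sbetw y x z -> x = y.
Proof. by move=> h1 h2; apply/val_inj/(betw_anti h1 h2). Qed.

Fact sub_trans x y z w :
  sbetw x y z -> sbetw x w y -> sbetw x w z /\ sbetw w y z.
Proof. exact: betw_trans. Qed.

Definition substructure : betweenness :=
  Betweenness sub_neq0 sub_refl sub_sym sub_anti sub_trans.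

End Substructure.

(* For #|T| = 3, the equation T = [set x; y; z] forces x, y, z distinct. *)
Definition collinear (B : betweenness) (T : {set B}) : bool :=
  [exists x, exists y, exists z, (T == [set x; y; z]) && betw x y z].

Definition cosize (B : betweenness) : nat :=
  #|[set T : {set B} | (#|T| == 3)%N && ~~ collinear T]|.

Definition has_structure (Phi : betweenness -> Prop) (n m : nat) : Prop :=
  exists B : betweenness, [/\ #|B| = n, cosize B = m & Phi B].

(* The minimum of the empty set is set to 0; as a genuine value is always     *)
(* greater than k, tau Phi n k = m with m > 0 implies that the minimum exists. *)
Definition tau (Phi : betweenness -> Prop) (n k : nat) : nat :=
  if pselect (exists m, `[< (k < m)%N /\ has_structure Phi n m >]) is left h
  then ex_minn h else 0%N.

(* weight u v = None means that {u, v} is not an edge. *)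
Record wgraph (R : realType) := WGraph {
  vertex :> finType;
  weight : vertex -> vertex -> option R;
  vertex_neq0 : (0 < #|vertex|)%N;
  weight_sym : forall u v, weight u v = weight v u;
  weight_irr : forall u, weight u u = None;
  weight_gt0 : forall u v w, weight u v = Some w -> 0 < w;
  wgraph_conn : forall u v, connect (fun a b => weight a b : bool) u v }.

Section Distance.
Variables (R : realType) (W : wgraph R).
Implicit Types (u v : W) (p : seq W).

Definition adj u v : bool := weight u v.

Fixpoint path_length u p : R :=
  if p is v :: p' then odflt 0 (weight u v) + path_length v p' else 0.

(* The set of lengths is finite and nonempty, hence the infimum is a minimum. *)
Definition dist u v : R :=
  inf [set l : R | exists p, [/\ path adj u p, uniq (u :: p), last u p = v
                               & l = path_length u p]]%classic.

Lemma adj_weight_ge0 u v : 0 <= odflt 0 (weight u v).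
Proof. by case E: (weight u v) => [w|] //=; exact/ltW/(weight_gt0 E). Qed.

Lemma path_length_ge0 u p : 0 <= path_length u p.
Proof.
by elim: p u => //= v p IH u; rewrite addr_ge0 ?adj_weight_ge0.
Qed.

Lemma path_length_cat u p q :
  path_length u (p ++ q) = path_length u p + path_length (last u p) q.
Proof. by elim: p u => [|v p IH] u /=; rewrite ?add0r // IH addrA. Qed.

Lemma simple_path u p : path adj u p ->
  exists q, [/\ path adj u q, uniq (u :: q), last u q = last u p
              & path_length u q <= path_length u p].
Proof.
elim: p u => [|v p IH] u; first by exists [::].
rewrite [path _ _ _]/= => /andP[uv /IH[q [vq Uq Lq lq]]].
have [|uq] := boolP (u \in v :: q); last first.
  exists (v :: q); split; [by rewrite /= uv|by rewrite cons_uniq uq|by []|].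
  by rewrite /= lerD2l.
have le_vp : path_length v q <= path_length u (v :: p).
  by rewrite /= (le_trans lq)// lerDr adj_weight_ge0.
rewrite inE => /predU1P[E|/splitPr E].
  by subst v; exists q.
case: E vq Uq Lq le_vp lq => p1 p2.
rewrite cat_path last_cat /= => /and3P[_ _ up2].
move=> /andP[_]; rewrite cat_uniq => /and3P[_ _ Up] Lq le_vp _.
exists p2; split=> //.
apply: le_trans le_vp; rewrite path_length_cat /= addrA lerDr.
by rewrite addr_ge0 ?path_length_ge0 ?adj_weight_ge0.
Qed.

Lemma dist_le u p : path adj u p -> dist u (last u p) <= path_length u p.
Proof.
move=> /simple_path[q [uq Uq Lq lq]]; apply: le_trans lq.
apply: ge_inf; last by exists q.
by exists 0 => _ [r [_ _ _ ->]]; exact: path_length_ge0.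
Qed.

Lemma le_dist u v (l : R) :
  (forall p, path adj u p -> uniq (u :: p) -> last u p = v ->
     l <= path_length u p) -> l <= dist u v.
Proof.
move=> hl; apply: lb_le_inf; last by move=> _ [p [up Up Lp ->]]; exact: hl.
have /connectP[p up ->] := wgraph_conn u v.
have [q [uq Uq Lq _]] := simple_path up.
by exists (path_length u q), q.
Qed.

Lemma dist_refl u : dist u u = 0.
Proof.
apply/eqP; rewrite eq_le (dist_le (p := [::]))//=.
by apply: le_dist => p _ _ _; exact: path_length_ge0.
Qed.

Lemma rev_path_length u p :
  path_length (last u p) (rev (belast u p)) = path_length u p.
Proof.
elim/last_ind: p => // p v IH.
rewrite last_rcons belast_rcons -cats1 path_length_cat /= addr0 -IH addrC.
by case: (lastP p) => [|p' w]; rewrite /= ?belast_rcons ?last_rcons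
     ?rev_cons -?rev_rcons ?rev_rcons /= ?(weight_sym v).
Qed.

Lemma dist_sym u v : dist u v = dist v u.
Proof.
suff le x y : dist x y <= dist y x by apply/eqP; rewrite eq_le !le.
apply: le_dist => p yp _ <-.
have := @dist_le (last y p) (rev (belast y p)).
rewrite rev_path (eq_path (e' := adj)); last first.
  by move=> a b; rewrite /adj weight_sym.
move=> /(_ yp); rewrite rev_path_length; congr (_ <= _).
congr dist; case: p {yp} => //= z p.
by rewrite rev_cons last_rcons.
Qed.

Lemma dist_triangle v u w : dist u w <= dist u v + dist v w.
Proof.
rewrite -lerBlDr; apply: le_dist => p up _ Lp.
rewrite lerBlDr addrC -lerBlDr; apply: le_dist => q vq _ Lq.
rewrite lerBlDr addrC -[in path_length v q]Lp -path_length_cat.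
rewrite -Lq -[in last v q]Lp -last_cat; apply: dist_le.
by rewrite cat_path up Lp.
Qed.

Lemma dist_eq0 u v : dist u v = 0 -> u = v.
Proof.
move=> d0; apply/eqP; apply: contraT => uv.
pose wt (e : W * W) : R := odflt 1 (weight e.1 e.2).
have wt_gt0 e : 0 < wt e.
  by rewrite /wt; case E: (weight _ _) => [w|] //=; exact: weight_gt0 E.
pose e := [arg min_(e < (u, v)) wt e]%O.
suff : wt e <= dist u v by rewrite d0 leNgt wt_gt0.
apply: le_dist => -[|x p] /=; first by move=> _ _ E; rewrite E eqxx in uv.
move=> /andP[ux _] _ _.
apply: (@le_trans _ _ (odflt 0 (weight u x))); last first.
  by rewrite lerDl path_length_ge0.
rewrite /e; case: arg_minP => // i _ /(_ (u, x) isT).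
by rewrite {2}/wt /=; move: ux; rewrite /adj; case: (weight u x).
Qed.

Definition graph_betw u v w : bool := dist u w == dist u v + dist v w.

Fact graph_betw_refl u w : graph_betw u u w.
Proof. by rewrite /graph_betw dist_refl add0r. Qed.

Fact graph_betw_sym u v w : graph_betw u v w -> graph_betw w v u.
Proof.
by rewrite /graph_betw (dist_sym w u) (dist_sym w v) (dist_sym v u) addrC.
Qed.

Fact graph_betw_anti u v w : graph_betw u v w -> graph_betw v u w -> u = v.
Proof.
move=> /eqP h1 /eqP; rewrite (dist_sym v u) => h2.
by apply: dist_eq0; lra.
Qed.

Fact graph_betw_trans u v w t :
  graph_betw u v w -> graph_betw u t v -> graph_betw u t w /\ graph_betw t v w.
Proof.
move=> /eqP h1 /eqP h2.
have := dist_triangle t u w; have := dist_triangle v t w.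
by rewrite /graph_betw; split; apply/eqP; lra.
Qed.

Definition graph_betweenness : betweenness :=
  Betweenness (vertex_neq0 W) graph_betw_refl graph_betw_sym
    graph_betw_anti graph_betw_trans.

End Distance.

Section LabelledGraphs.
Variable R : realType.

(* Edge weights between natural-number labels, to be restricted to 'I_n. *)
Definition labels := nat -> nat -> option R.

(* The unit-weight path a, a + 1, ..., b. *)
Definition path_labels (a b : nat) : labels := fun i j =>
  if [&& a <= i <= b, a <= j <= b & (j == i.+1) || (i == j.+1)]%N
  then Some 1 else None.

Definition set_edge (u v : nat) (w : option R) (E : labels) : labels :=
  fun i j => if ((i == u) && (j == v)) || ((i == v) && (j == u))
             then w else E i j.

Definition add_edge u v (w : R) E := set_edge u v (Some w) E.
Definition del_edge u v E := set_edge u v None E.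

Definition wf_labels (E : labels) : Prop :=
  [/\ forall i j, E i j = E j i, forall i, E i i = None
    & forall i j w, E i j = Some w -> 0 < w].

Lemma wf_path a b : wf_labels (path_labels a b).
Proof.
rewrite /path_labels; split=> [i j|i|i j w].
- by rewrite andbCA orbC.
- by rewrite ifF //; lia.
- by case: ifP => // _ [<-].
Qed.

Lemma wf_add u v w E :
  u != v -> 0 < w -> wf_labels E -> wf_labels (add_edge u v w E).
Proof.
move=> uv w0 [s i0 p]; rewrite /add_edge /set_edge; split=> [i j|i|i j x].
- by rewrite s orbC ![(j == _) && _]andbC.
- by rewrite ifF //; lia.
- by case: ifP => [_ [<-]|_ /p].
Qed.

Lemma wf_del u v E : wf_labels E -> wf_labels (del_edge u v E).
Proof.
move=> [s i0 p]; rewrite /del_edge /set_edge; split=> [i j|i|i j x].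
- by rewrite s orbC ![(j == _) && _]andbC.
- by rewrite i0; case: ifP.
- by case: ifP => // _ /p.
Qed.

Lemma conn_labels n (E : labels) (r : nat) (rk : nat -> nat) :
  (r < n)%N -> wf_labels E ->
  (forall i, (i < n)%N -> i != r ->
     exists j, [/\ (j < n)%N, (rk j < rk i)%N & (E i j : bool)]) ->
  forall u v : 'I_n, connect (fun a b : 'I_n => E a b : bool) u v.
Proof.
move=> rn [s _ _] hE.
have sc : connect_sym (fun a b : 'I_n => E a b : bool).
  by apply: sym_connect_sym => a b; rewrite s.
suff to_r (u : 'I_n) : connect (fun a b : 'I_n => E a b : bool) u (Ordinal rn).
  by move=> u v; apply: (connect_trans (to_r u)); rewrite sc.
have [k] := ubnP (rk u); elim: k u => // k IH u uk.
have [ur|ur] := eqVneq (u : nat) r.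
  by rewrite (_ : u = Ordinal rn) ?connect0//; apply: val_inj.
have [j [jn jr uj]] := hE _ (ltn_ord u) ur.
apply: (@connect_trans _ _ (Ordinal jn)); first exact: connect1.
by apply: IH; apply: leq_trans jr _.
Qed.

Definition labelled_graph n (E : labels) (n_gt0 : (0 < n)%N) (wfE : wf_labels E)
    (cE : forall u v : 'I_n, connect (fun a b : 'I_n => E a b : bool) u v) :
    wgraph R.
Proof.
refine (@WGraph R 'I_n (fun i j => E i j) _ _ _ _ cE); case: wfE => s i0 p.
- by rewrite card_ord.
- by move=> u v; exact: s.
- by move=> u; exact: i0.
- by move=> u v w; exact: p.
Defined.

Definition C4_labels : labels := add_edge 3%N 0%N 1 (path_labels 0%N 3%N).

Fact C4_wf : wf_labels C4_labels.
Proof. by apply: wf_add => //; exact: wf_path. Qed.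

Fact C4_conn (u v : 'I_4) :
  connect (fun a b : 'I_4 => C4_labels a b : bool) u v.
Proof.
apply: (@conn_labels _ _ 0 id) => //; first exact: C4_wf.
by move=> [|[|[|[|//]]]] // _ _; [exists 0%N|exists 1%N|exists 2].
Qed.

Definition C4 : wgraph R := labelled_graph (n := 4%N) isT C4_wf C4_conn.

Definition K3_labels : labels := fun i j => if i != j then Some 1 else None.

Fact K3_wf : wf_labels K3_labels.
Proof.
rewrite /K3_labels; split=> [i j|i|i j w].
- by rewrite eq_sym.
- by rewrite eqxx.
- by case: ifP => // _ [<-].
Qed.

Fact K3_conn (u v : 'I_3) :
  connect (fun a b : 'I_3 => K3_labels a b : bool) u v.
Proof.
apply: (@conn_labels _ _ 0 id) => //; first exact: K3_wf.
by move=> [|i] // _ _; exists 0%N.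
Qed.

Definition K3 : wgraph R := labelled_graph (n := 3%N) isT K3_wf K3_conn.

(* In the three families below, the vertices are encoded in 'I_n as follows:  *)
(* x_i is the label i for 1 <= i <= n - 2, y is n - 1 and z is 0.             *)
Section Families.
Variables (n : nat) (n_ge4 : (4 <= n)%N).
Let y := n.-1.
Let z := 0%N.

Fact n_gt0 : (0 < n)%N. Proof. exact: leq_trans n_ge4. Qed.

Definition Q_labels : labels :=
  add_edge z 1%N 1 (add_edge y 1%N 1 (path_labels 1%N (n - 2)%N)).

Fact Q_wf : wf_labels Q_labels.
Proof.
by apply: wf_add => //; apply: wf_add => //;
  [rewrite /y; lia | exact: wf_path].
Qed.

Fact Q_conn (u v : 'I_n) : connect (fun a b : 'I_n => Q_labels a b : bool) u v.
Proof.
apply: (@conn_labels _ _ 1 (fun i => if i == 0%N then 2 else i)).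
- lia.
- exact: Q_wf.
move=> i i_n i1.
rewrite /Q_labels /add_edge /set_edge /path_labels /y /z.
have [->|i0] := eqVneq i 0%N; first by exists 1%N; split; [lia|by []|].
have [->|iy] := eqVneq i n.-1.
  by exists 1%N; split; [lia|move=> /=; do ?[case: ifP => ?]; lia|rewrite !eqxx; case: ifP].
exists i.-1; split; [lia|move=> /=; do ?[case: ifP => ?]; lia|].
by do ![case: ifP => //]; lia.
Qed.

Definition Q_graph : wgraph R := labelled_graph n_gt0 Q_wf Q_conn.

Definition S_labels : labels :=
  add_edge y z (n - 2)%:R
    (add_edge (n - 2)%N z 2 (add_edge 1%N y 1 (path_labels 1%N (n - 2)%N))).

Fact S_wf : wf_labels S_labels.
Proof.
apply: wf_add; [by rewrite /y /z; lia|by rewrite ltr0n; lia|].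
apply: wf_add; [by rewrite /z; lia|by rewrite ltr0n|].
by apply: wf_add => //; [by rewrite /y; lia|exact: wf_path].
Qed.

Fact S_conn (u v : 'I_n) : connect (fun a b : 'I_n => S_labels a b : bool) u v.
Proof.
apply: (@conn_labels _ _ 1 (fun i => if i == 0%N then n else i)).
- lia.
- exact: S_wf.
move=> i i_n i1.
rewrite /S_labels /add_edge /set_edge /path_labels /y /z.
have [->|i0] := eqVneq i 0%N.
  exists (n - 2)%N; split; [lia|move=> /=; do ?[case: ifP => ?]; lia|].
  by rewrite !eqxx !orbT; case: ifP.
have [->|iy] := eqVneq i n.-1.
  exists 1%N; split; [lia|move=> /=; do ?[case: ifP => ?]; lia|].
  by rewrite !eqxx !orbT; do ?case: ifP.
exists i.-1; split; [lia|move=> /=; do ?[case: ifP => ?]; lia|].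
by do ![case: ifP => //]; lia.
Qed.

Definition S_graph : wgraph R := labelled_graph n_gt0 S_wf S_conn.

Variables (i : nat) (i_I : (1 <= i <= n - 3)%N).

Definition R_labels : labels :=
  add_edge y i.+1 2 (add_edge z i.+1 2 (add_edge y i 1 (add_edge z i 1
    (del_edge i i.+1 (path_labels 1%N (n - 2)%N))))).

Fact R_wf : wf_labels R_labels.
Proof.
apply: wf_add; [by rewrite /y; lia|by rewrite ltr0n|].
apply: wf_add; [by rewrite /z; lia|by rewrite ltr0n|].
apply: wf_add; [by rewrite /y; lia|exact: ltr01|].
apply: wf_add; [by rewrite /z; lia|exact: ltr01|].
exact/wf_del/wf_path.
Qed.

Fact R_conn (u v : 'I_n) : connect (fun a b : 'I_n => R_labels a b : bool) u v.
Proof.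
apply: (@conn_labels _ _ 1
  (fun j => if (j == 0%N) || (j == n.-1) then i.*2.+1 else j.*2)).
- lia.
- exact: R_wf.
move=> j j_n j1.
rewrite /R_labels /add_edge /del_edge /set_edge /path_labels /y /z.
have [->|j0] := eqVneq j 0%N.
  exists i; split; [lia|move=> /=; do ?[case: ifP => ?]; lia|].
  by do ![case: ifP => //]; lia.
have [->|jy] := eqVneq j n.-1.
  exists i; split; [lia|move=> /=; do ?[case: ifP => ?]; lia|].
  by do ![case: ifP => //]; lia.
have [->|ji] := eqVneq j i.+1.
  exists 0%N; split; [lia|move=> /=; do ?[case: ifP => ?]; lia|].
  by do ![case: ifP => //]; lia.
exists j.-1; split; [lia|move=> /=; do ?[case: ifP => ?]; lia|].
by do ![case: ifP => //]; lia.
Qed.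

Definition R_graph : wgraph R := labelled_graph n_gt0 R_wf R_conn.

End Families.
End LabelledGraphs.

Definition regular (R : realType) (B : betweenness) : Prop :=
  forall (Y : {set B}) (Y_neq0 : (0 < #|Y|)%N), #|Y| = 4%N ->
    ~ iso (substructure Y_neq0) (graph_betweenness (C4 R)).

(* Main.v *)
Require Import Defs.
From mathcomp Require Import all_boot all_order all_algebra.
From mathcomp Require Import boolp reals.
From mathcomp Require Import zify.

Set Implicit Arguments.
Unset Strict Implicit.
Unset Printing Implicit Defensive.

Import Order.TTheory GRing.Theory Num.Theory.

(* By (P2)-(P4) and the absence of C_4, a triangle-free set of points is a line
   (line_exists). If all triangles contain two points y, z and some {y, z, c} is
   collinear, then removing y or z leaves a line; comparing the two lines shows
   that c is unique and forces one of the configurations Q, R, S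
   (pencil_exists). Hence five points with at most two triangles have exactly
   two, sharing two points, and by induction n >= 5 points with at least one and
   at most n - 3 triangles have exactly n - 3, all through a common pair
   (sparse_sunflower). Conversely the distances in Q, R, S are those of a line,
   except between y and z. *)

(** The two lines left by removing y or z share all the other points, so only the triples {y, z, d}
    remain open. If the sides of c on which the lines put y and z match the betweenness of y, z, c,
    then every {y, z, d} is collinear. A triangle therefore forces one of two mismatches: c is
    between y and z although both are on one side of it, or c is an end of the triple although y and
    z are on its two sides. In either mismatch, (P2)-(P4) and the absence of squares make every d
    other than c a triangle with y and z. Of the n - 2 points off the pair only c drops out, whence
    n - 3. The induction starts at order 5 because order 4 gives no leverage: one triangle is
    legitimate there, and five points with one triangle are excluded by the uniqueness of c, not by
    counting. Q, R and S enter through one notion, the pencil, so that regularity and co-size are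
    derived once for all three; graphs matter only when distances are computed. *)

Definition aligned (B : betweenness) (x y z : B) : bool :=
  [|| betw x y z, betw y z x | betw z x y].

(** The nontrivial betweennesses of the 4-cycle a b c d: each vertex is between its two
    neighbours. *)
Definition square (B : betweenness) (a b c d : B) : bool :=
  [&& betw a b c, betw b c d, betw c d a & betw d a b].

Definition square_free (B : betweenness) : Prop :=
  forall a b c d : B, uniq [:: a; b; c; d] -> ~~ square a b c d.

Definition between_in (T : Type) (h : T -> int) (x y z : T) : bool :=
  ((h x <= h y <= h z) || (h z <= h y <= h x))%R.

(** Only the order of the coordinates counts, so they may be exchanged for any others in the same
    order. Integers leave room for a point beyond all others and turn comparisons of lines into
    linear arithmetic. *)
Definition line_on (B : betweenness) (A : {set B}) (h : B -> int) : Prop :=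
  {in A &, injective h} /\
  {in A & &, forall x y z, betw x y z = between_in h x y z}.

Definition triangles (B : betweenness) : {set {set B}} :=
  [set T : {set B} | (#|T| == 3) && ~~ collinear T].

Definition triangles_in (B : betweenness) (A : {set B}) : {set {set B}} :=
  [set T in triangles B | T \subset A].

(** * Collinear triples, triangles and lines *)

Section Basics.
Variable B : betweenness.
Implicit Types (a b c d x y z w : B) (A : {set B}).

Lemma betwC x y z : betw x y z = betw z y x.
Proof. by apply/idP/idP; exact: betw_sym. Qed.

Lemma betw_cut x y z w : betw x y z -> betw x w y -> betw x w z.
Proof. by move=> h1 h2; case: (betw_trans h1 h2). Qed.

Lemma betw_shift x y z w : betw x y z -> betw x w y -> betw w y z.
Proof. by move=> h1 h2; case: (betw_trans h1 h2). Qed.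

Lemma betw_reflr x y : betw x y y.
Proof. by rewrite betwC betw_refl. Qed.

Lemma betw_id x y : betw x y x -> x = y.
Proof. by move=> h; apply: (betw_anti h); apply: betw_reflr. Qed.

Lemma alignedC x y z : aligned x y z = aligned y x z.
Proof.
by rewrite /aligned (betwC y x z) (betwC x z y) (betwC z y x) orbC -orbA orbCA.
Qed.

Lemma alignedR x y z : aligned x y z = aligned y z x.
Proof. by rewrite /aligned orbC -orbA. Qed.

Lemma aligned_refl x y : aligned x x y.
Proof. by rewrite /aligned betw_refl. Qed.

Lemma set3_uniq x y z T : uniq [:: x; y; z] -> T = [set x; y; z] -> #|T| = 3.
Proof.
rewrite /= !inE negb_or andbT => /andP[/andP[xy xz] yz] ->.
by rewrite -setUA cardsU1 !inE negb_or xy xz cards2 yz.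
Qed.

Lemma collinear_set3 x y z :
  uniq [:: x; y; z] -> collinear [set x; y; z] = aligned x y z.
Proof.
rewrite /= !inE negb_or andbT => /andP[/andP[xy xz] yz].
have st (p q r s : B) : s \in [set p; q; r] = [|| s == p, s == q | s == r].
  by rewrite !inE -orbA.
apply/existsP/idP => [[u /existsP[v /existsP[w /andP[/eqP E uvw]]]]|].
  have card3 : #|[set u; v; w]| = 3.
    by rewrite -E; apply: (@set3_uniq x y z) => //=; rewrite !inE negb_or xy xz yz.
  have uvw_uniq : [&& u != v, u != w & v != w].
    move: card3; rewrite -setUA cardsU1 cards2 !inE negb_or.
    by case: (u == v); case: (u == w); case: (v == w).
  have [uE vE wE] : [/\ u \in [set x; y; z], v \in [set x; y; z] & w \in [set x; y; z]].
    by rewrite E !st !eqxx !orbT.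
  have al : aligned u v w by rewrite /aligned uvw.
  move: uvw_uniq al; rewrite !st in uE vE wE.
  case/or3P: uE => /eqP ->; case/or3P: vE => /eqP ->; case/or3P: wE => /eqP ->;
    rewrite ?eqxx ?andbF //= => _ al //.
  - by rewrite alignedC alignedR.
  - by rewrite alignedC.
  - by rewrite alignedR.
  - by rewrite -alignedR.
  - by rewrite alignedC -alignedR.
case/or3P => h.
- by exists x; apply/existsP; exists y; apply/existsP; exists z; rewrite eqxx.
- exists y; apply/existsP; exists z; apply/existsP; exists x; rewrite h andbT.
  by apply/eqP/setP=> s; rewrite !st orbC -orbA.
- exists z; apply/existsP; exists x; apply/existsP; exists y; rewrite h andbT.
  by apply/eqP/setP=> s; rewrite !st orbA orbC.
Qed.

Lemma triangleP x y z :
  reflect (uniq [:: x; y; z] /\ ~~ aligned x y z) ([set x; y; z] \in triangles B).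
Proof.
rewrite inE; apply: (iffP andP) => [[/eqP c3 nc]|[u na]]; last first.
  by rewrite collinear_set3 // na (set3_uniq u erefl).
have u : uniq [:: x; y; z].
  move: c3; rewrite -setUA cardsU1 cards2 !inE /= !inE negb_or.
  by case: (x == y); case: (x == z); case: (y == z).
by rewrite -collinear_set3.
Qed.

Lemma triangle_card T : T \in triangles B -> #|T| = 3.
Proof. by rewrite inE => /andP[/eqP]. Qed.

Lemma card3E (A : {set B}) : #|A| = 3 ->
  exists x y z, uniq [:: x; y; z] /\ A = [set x; y; z].
Proof.
move=> A3; have [x xA] : exists x, x \in A by apply/set0Pn; rewrite -card_gt0 A3.
have : #|A :\ x| == 2 by rewrite (cardsD1 x) xA add1n in A3; case: A3 => ->.
case/cards2P => y [z [yz E]]; exists x, y, z.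
have : (x \notin [set y; z]) by rewrite -E !inE eqxx.
rewrite !inE => H; split; first by rewrite /= !inE H yz.
by rewrite -(setD1K xA) E setUA.
Qed.

Lemma linear_aligned A : triangles_in A = set0 ->
  {in A & &, forall x y z, aligned x y z}.
Proof.
move=> A0 x y z xA yA zA.
case: (eqVneq x y) => [->|xy]; first exact: aligned_refl.
case: (eqVneq y z) => [->|yz]; first by rewrite alignedR aligned_refl.
case: (eqVneq x z) => [->|xz]; first by rewrite alignedC alignedR aligned_refl.
apply/idPn => na; have : [set x; y; z] \in triangles_in A.
  rewrite inE; apply/andP; split.
    by apply/triangleP; rewrite /= !inE negb_or xy xz yz.
  by apply/subsetP => t; rewrite !inE -orbA => /or3P[] /eqP ->.
by rewrite A0 inE.
Qed.

(* The ends a, b of a segment with the most points enclose everything, and the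
   number of points between a and x is then a coordinate of x. *)
Lemma line_exists A : square_free B -> triangles_in A = set0 ->
  exists h, line_on A h.
Proof.
move=> sf /linear_aligned lin.
have [->|[o oA]] := set_0Vmem A.
  by exists (fun=> 0%R); split=> [x|x]; rewrite inE.
pose seg a b := [set w in A | betw a w b].
pose P (p : B * B) := (p.1 \in A) && (p.2 \in A).
have [|[a b]] := @arg_maxnP _ (o, o) P (fun p => #|seg p.1 p.2|); first by rewrite /P oA.
rewrite /P /= => /andP[aA bA] mx.
have mx' u v x : u \in A -> v \in A -> x \in A -> seg u v \subset seg x v ->
    #|seg u v| = #|seg a b| -> betw u x v.
  move=> uA vA xA sub E; apply/idPn => nx.
  have /mx/= : P (x, v) by rewrite /P xA.
  rewrite -E => /(conj sub); rewrite leqNgt => -[/subset_leq_card].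
  have /proper_card : seg u v \proper seg x v.
    rewrite properE sub; apply/subsetPn; exists x; first by rewrite inE xA betw_refl.
    by rewrite inE (negPf nx) andbF.
  by move=> ->.
have segC u v : seg u v = seg v u by apply/setP=> w; rewrite !inE betwC.
have grow u v x : u \in A -> v \in A -> x \in A -> betw x u v ->
    seg u v \subset seg x v.
  move=> uA vA xA xuv; apply/subsetP => w; rewrite !inE => /andP[-> uwv] /=.
  by rewrite betwC; apply: (@betw_cut v u); rewrite betwC.
have ends x : x \in A -> betw a x b.
  move=> xA; case/or3P: (lin x a b xA aA bA) => h.
  - by apply: mx' => //; apply: grow.
  - rewrite betwC; apply: mx' => //; last by rewrite segC.
    by apply: grow => //; rewrite betwC.
  - by rewrite betwC.
have tot x y : x \in A -> y \in A -> betw a x y || betw a y x.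
  move=> xA yA; have ax := ends _ xA; have ay := ends _ yA.
  case: (eqVneq x a) => [->|xa]; first by rewrite betw_refl.
  case: (eqVneq y a) => [->|ya]; first by rewrite betw_refl orbT.
  case: (eqVneq x y) => [->|xy]; first by rewrite betw_reflr.
  case: (eqVneq x b) => [->|xb]; first by rewrite ay orbT.
  case: (eqVneq y b) => [->|yb]; first by rewrite ax.
  have ab : a != b by apply: contraNneq xa => E; rewrite E in ax *; rewrite (betw_id ax).
  case/or3P: (lin a x y aA xA yA) => [->//|xya|yax]; first by rewrite (betwC a y x) xya orbT.
  (* Here [a] is between [x] and [y]. Of the three ways to align [x], [y], [b], two clash with (P3),
     and the third, [b] between [x] and [y], completes the square [x a y b]. *)
  exfalso; have : ~~ square x a y b.
    by apply: sf; rewrite /= !inE !negb_or xa xy xb ab yb eq_sym ya.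
  rewrite /square (betwC x a y) yax ay (betwC b x a) ax !andbT /= => nb.
  case/or3P: (lin x y b xA yA bA) => h.
  - have h2 : betw x a b by apply: (betw_cut h); rewrite betwC.
    by rewrite (betw_anti ax h2) eqxx in xa.
  - by rewrite h in nb.
  - have h1 : betw y x b by rewrite betwC.
    have h2 := betw_cut h1 yax; by rewrite (betw_anti ay h2) eqxx in ya.
pose r x := #|seg a x|; exists (fun x => Posz (r x)).
have rlt x y : x \in A -> y \in A -> betw a x y -> x != y -> r x < r y.
  move=> xA yA axy xy; apply: proper_card; rewrite properE; apply/andP; split.
    by apply/subsetP => w; rewrite !inE => /andP[-> h] /=; exact: betw_cut axy h.
  apply/subsetPn; exists y; first by rewrite inE yA betw_reflr.
  rewrite inE yA /=; apply/negP => ayx; case/eqP: xy.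
  by apply: (betw_anti (z := a)); rewrite betwC.
have rle x y : x \in A -> y \in A -> betw a x y = (r x <= r y).
  move=> xA yA; case: (eqVneq x y) => [->|xy]; first by rewrite leqnn betw_reflr.
  apply/idP/idP => [h|h]; first by rewrite ltnW // rlt.
  case/orP: (tot _ _ xA yA) => // h'.
  by have := rlt _ _ yA xA h'; rewrite eq_sym xy ltnNge h => /(_ isT).
have rinj x y : x \in A -> y \in A -> r x = r y -> x = y.
  move=> xA yA E; apply/eqP/idPn => xy.
  case/orP: (tot _ _ xA yA) => h.
    by have := rlt _ _ xA yA h xy; rewrite E ltnn.
  by rewrite eq_sym in xy; have := rlt _ _ yA xA h xy; rewrite E ltnn.
split=> [x y xA yA [] /rinj -> //|x y z xA yA zA].
have bt u v w : u \in A -> v \in A -> w \in A -> r u <= r v -> r v <= r w -> betw u v w.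
  by move=> uA vA wA; rewrite -!rle // => h1 h2; apply: betw_shift h2 h1.
rewrite /between_in !lez_nat; apply/idP/idP => [h|]; last first.
  by case/orP=> /andP[h1 h2]; [|rewrite betwC]; apply: bt.
have anti u v w : u \in A -> v \in A -> w \in A -> betw u v w -> betw v u w -> r u = r v.
  by move=> _ _ _ h1 h2; rewrite (betw_anti h1 h2).
have := anti _ _ _ xA yA zA h.
have := anti _ _ _ zA yA xA; rewrite betwC => /(_ h).
have := bt _ _ _ yA xA zA; have := bt _ _ _ zA xA yA; rewrite (betwC z x y).
have := bt _ _ _ yA zA xA; have := bt _ _ _ xA zA yA; rewrite (betwC x z y).
case: (betw y x z); case: (betw y z x); lia.
Qed.

End Basics.

Ltac add_new p :=
  let P := type of p in
  match goal with
  | _ : P |- _ => fail 1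
  | _ => pose proof p
  end.

(** * Two lines with a common part *)

Ltac betw_clash :=
  match goal with
  | h : is_true ?b, k : is_true (~~ ?b) |- _ => by rewrite h in k
  | h : is_true (betw ?x ?y ?z), k : is_true (betw ?y ?x ?z) |- _ =>
      match goal with
      | n : is_true (x != y) |- _ => by move: n; rewrite (betw_anti h k) eqxx
      | n : is_true (y != x) |- _ => by move: n; rewrite (betw_anti h k) eqxx
      end
  end.

(* Closes the known betweennesses under (P2) and (P4) until one of them
   contradicts (P3) or a negated betweenness. *)
Ltac betw_absurd :=
  exfalso;
  repeat match goal with
  | h : is_true (betw _ _ _) |- _ => add_new (betw_sym h)
  end;
  do 20 (try betw_clash;
  match goal with
  | h : is_true (betw ?x ?y _), k : is_true (betw ?x ?w ?y) |- _ =>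
      tryif constr_eq w y then fail else
      first [add_new (betw_cut h k); pose proof (betw_sym (betw_cut h k))
            |add_new (betw_shift h k); pose proof (betw_sym (betw_shift h k))]
  end).

Ltac order_lia :=
  repeat match goal with
  | h : is_true (_ \in _) |- _ => clear h
  | h : is_true (betw _ _ _) |- _ => clear h
  | h : is_true (~~ _) |- _ => clear h
  | h : is_true (aligned _ _ _) |- _ => clear h
  | h : forall _, _ |- _ => clear h
  | h : line_on _ _ |- _ => clear h
  | h : square_free _ |- _ => clear h
  end; lia.

(* s = true: y and z lie at the same place of the line, next to c, and c is
   between them (R, and Q when this place is at an end of the line).
   s = false: y and z are the two ends of the line and y is between c, its
   neighbour, and z (S). In both cases the triangles are the {y, z, d} with
   d != c. *)
Record pencil_on (B : betweenness) (A : {set B}) (s : bool) (h : B -> int)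
    (y z c : B) : Prop := PencilOn {
  pencil_y : y \in A;
  pencil_z : z \in A;
  pencil_c : c \in A;
  pencil_uniq : uniq [:: y; z; c];
  pencil_line_y : line_on (A :\ z) h;
  pencil_line_z : line_on (A :\ y) h;
  pencil_betw : forall d, d \in A -> uniq [:: y; z; d] ->
    [/\ betw y d z = s && (d == c), betw d y z = ~~ s && (d == c)
      & betw y z d = false];
  pencil_place : forall d, d \in A -> uniq [:: y; z; d] ->
    if s then [/\ h y = h z, (h c < h y)%R & (h d <= h c)%R || (h y < h d)%R]
    else [/\ (h y < h d)%R, (h d < h z)%R & (h c <= h d)%R] }.

Section TwoLines.
Variables (B : betweenness).
Hypothesis sf : square_free B.
Implicit Types (a b c d x y z w : B) (A : {set B}) (h : B -> int).

Lemma line_opp A h : line_on A h -> line_on A (fun x => - h x)%R.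
Proof.
move=> [hi hb]; split=> [x y xA yA /oppr_inj e|x y z xA yA zA].
  exact: hi.
by rewrite hb // /between_in; lia.
Qed.

Lemma line_homo A h h' : line_on A h ->
  {in A &, forall x y, (h' x < h' y)%R = (h x < h y)%R} -> line_on A h'.
Proof.
move=> [hi hb] E; split=> [x y xA yA e|x y z xA yA zA].
  by apply: hi => //; have := E x y xA yA; have := E y x yA xA; rewrite e ltxx; lia.
by rewrite hb // /between_in !leNgt !E.
Qed.

Lemma line_betw A h x y z : line_on A h -> x \in A -> y \in A -> z \in A ->
  (h x <= h y)%R -> (h y <= h z)%R -> betw x y z.
Proof. by move=> [_ hb] xA yA zA; rewrite hb // /between_in => -> ->. Qed.

(** * Sides of c on the two lines against the betweenness of y, z, c *)

Section Cases.
Variables (A : {set B}) (y z c d : B) (h1 h2 : B -> int).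
Hypotheses (yA : y \in A) (zA : z \in A) (cA : c \in A) (dA : d \in A).
Hypotheses (yz : y != z) (cy : c != y) (cz : c != z) (dy : d != y) (dz : d != z) (cd : c != d).
Hypotheses (l1 : line_on (A :\ z) h1) (l2 : line_on (A :\ y) h2).
Hypothesis agree : (h1 c < h1 d)%R = (h2 c < h2 d)%R.
Hypothesis c_y : (h1 c < h1 y)%R.

Let m1 x : x \in A -> x != z -> x \in A :\ z.
Proof. by rewrite !inE => -> ->. Qed.
Let m2 x : x \in A -> x != y -> x \in A :\ y.
Proof. by rewrite !inE => -> ->. Qed.
Let y1 : y \in A :\ z. Proof. exact: m1. Qed.
Let c1 : c \in A :\ z. Proof. exact: m1. Qed.
Let d1 : d \in A :\ z. Proof. exact: m1. Qed.
Let z2 : z \in A :\ y. Proof. by apply: m2; rewrite // eq_sym. Qed.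
Let c2 : c \in A :\ y. Proof. exact: m2. Qed.
Let d2 : d \in A :\ y. Proof. exact: m2. Qed.
Let b1 u v w := @line_betw _ _ u v w l1.
Let b2 u v w := @line_betw _ _ u v w l2.
Let neq1 u v : u \in A :\ z -> v \in A :\ z -> u != v -> h1 u <> h1 v.
Proof. by move=> uA vA uv E; rewrite ((proj1 l1) u v uA vA E) eqxx in uv. Qed.
Let neq2 u v : u \in A :\ y -> v \in A :\ y -> u != v -> h2 u <> h2 v.
Proof. by move=> uA vA uv E; rewrite ((proj1 l2) u v uA vA E) eqxx in uv. Qed.

Let betw1 : [\/ [/\ (h1 d < h1 c)%R, (h2 d < h2 c)%R & betw d c y],
  [/\ (h1 c < h1 d)%R, (h1 d < h1 y)%R, (h2 c < h2 d)%R & betw c d y] |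
  [/\ (h1 c < h1 d)%R, (h1 y < h1 d)%R, (h2 c < h2 d)%R & betw c y d]].
Proof.
have := neq1 c1 d1 cd; have := neq1 d1 y1 dy; have := neq2 c2 d2 cd => n1 n2 n3.
case: (ltrP (h1 c) (h1 d)) => h; last first.
  by constructor 1; split; [order_lia|order_lia|apply: b1 => //; order_lia].
case: (ltrP (h1 d) (h1 y)) => h'.
  by constructor 2; split; [order_lia|order_lia|order_lia|apply: b1 => //; order_lia].
by constructor 3; split; [order_lia|order_lia|order_lia|apply: b1 => //; order_lia].
Qed.

Let betw2 : [\/ (h2 d < h2 c)%R /\ [\/ (h2 z < h2 d)%R /\ betw z d c,
      [/\ (h2 d < h2 z)%R, (h2 z < h2 c)%R & betw d z c] | (h2 c < h2 z)%R /\ betw d c z],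
   (h2 c < h2 d)%R /\ [\/ (h2 d < h2 z)%R /\ betw c d z,
      [/\ (h2 z < h2 d)%R, (h2 c < h2 z)%R & betw c z d] | (h2 z < h2 c)%R /\ betw d c z] |
   False].
Proof.
have nzd := neq2 d2 z2 dz; have nzc := neq2 c2 z2 cz; have n := neq2 c2 d2 cd.
case: (ltrP (h2 c) (h2 d)) => h.
  constructor 2; split => //.
  case: (ltrP (h2 d) (h2 z)) => h'; first by constructor 1; split => //; apply: b2 => //;
    order_lia.
  case: (ltrP (h2 c) (h2 z)) => h''; first by constructor 2; split;
    [order_lia|order_lia|apply: b2 => //; order_lia].
  by constructor 3; split; [order_lia|rewrite betwC; apply: b2 => //; order_lia].
constructor 1; split; first order_lia.
case: (ltrP (h2 z) (h2 d)) => h'; first by constructor 1; split => //; apply: b2 => //;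
  order_lia.
case: (ltrP (h2 c) (h2 z)) => h''; first by constructor 3; split => //; apply: b2 => //;
  order_lia.
by constructor 2; split; [order_lia|order_lia|apply: b2 => //; order_lia].
Qed.

(** Runs through the places of [d] on both lines and drops the combinations that order [c] and [d]
    differently, which [agree] excludes. *)
Ltac orders := case: betw1 => [] [] *; case: betw2 => [[? [[??]|[???]|[??]]]|[?
  [[??]|[???]|[??]]]|//]; try (exfalso; order_lia).

Let notal : ~~ aligned y z d -> [/\ ~~ betw y z d, ~~ betw z d y & ~~ betw d y z].
Proof. by rewrite /aligned !negb_or => /and3P. Qed.

(** Lines and betweenness both put [c] between [y] and [z]. Wherever [d] lies, (P4) then aligns it
    with [y] and [z]. *)
Lemma opposite_sides : betw y c z -> (h2 z < h2 c)%R -> aligned y z d.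
Proof.
move=> ycz zc; apply/idPn => /notal[? ? ?].
by orders; betw_absurd.
Qed.

(** The other consistent situation: [c] is an end of the triple and the lines put [y] and [z] on one
    side of it. *)
Lemma same_side : betw c y z -> (h2 c < h2 z)%R -> aligned y z d.
Proof.
move=> ycz zc; apply/idPn => /notal[? ? ?].
by orders; betw_absurd.
Qed.

Let nsq a b x w : uniq [:: a; b; x; w] -> betw a b x -> betw b x w -> betw x w a -> betw w
  a b -> False.
Proof. by move=> u e1 e2 e3 e4; have := sf u; rewrite /square e1 e2 e3 e4. Qed.

(** First mismatch. A [d] between [c] and [y], or between [c] and [z], clashes with [y c z]. A [d]
    beyond both could only be aligned as [y d z], and then [y c z d] is a square. *)
Lemma middle_place : betw y c z -> (h2 c < h2 z)%R ->
  [/\ ~~ aligned y z d, (h1 d < h1 c)%R || (h1 y < h1 d)%R & (h2 d < h2 c)%R || (h2 z < h2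
    d)%R].
Proof.
move=> ycz zc.
have cyclic : betw c y d -> betw c z d -> ~~ betw y d z.
  move=> h1' h2'; apply/negP => h.
  apply: (@nsq y c z d) => //; rewrite 1?betwC //.
  by rewrite /= !inE !negb_or eq_sym cy yz eq_sym dy cz cd eq_sym dz.
rewrite /aligned !negb_or (betwC z d y); split.
- apply/and3P; split; apply/negP => h; orders; try betw_absurd.
  by apply: (negP (cyclic _ _) h).
- by orders; try order_lia; betw_absurd.
- by orders; try order_lia; betw_absurd.
Qed.

(** Second mismatch. Every [d] falls between [z] and [c] on one line and behind [c], seen from [y],
    on the other. The alignment [y z d] would close the square [z d c y]. *)
Lemma extreme_place : betw c y z -> (h2 z < h2 c)%R ->
  [/\ ~~ aligned y z d, (h1 d < h1 c)%R & (h2 z < h2 d)%R].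
Proof.
move=> cyz zc.
have cyclic : betw z d c -> betw d c y -> ~~ betw y z d.
  move=> h1' h2'; apply/negP => h.
  apply: (@nsq z d c y) => //; rewrite 1?betwC //.
  by rewrite /= !inE !negb_or eq_sym dz eq_sym cz eq_sym yz eq_sym cd dy cy.
rewrite /aligned !negb_or; split.
- apply/and3P; split; apply/negP => h; orders; try betw_absurd.
  by apply: (negP (cyclic _ _) h).
- by orders; try order_lia; betw_absurd.
- by orders; try order_lia; betw_absurd.
Qed.

End Cases.
Lemma line_neq A h x y : line_on A h -> x \in A -> y \in A -> x != y ->
  h x <> h y.
Proof. by move=> [hi _] xA yA xy E; rewrite (hi x y xA yA E) eqxx in xy. Qed.

(** Betweenness fixes the order of three points up to reversal, and one common pair fixes the
    direction. *)
Lemma lines_agree A1 A2 h1 h2 u v w : line_on A1 h1 -> line_on A2 h2 ->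
  {subset [:: u; v; w] <= A1} -> {subset [:: u; v; w] <= A2} ->
  uniq [:: u; v; w] -> (h1 u < h1 v)%R = (h2 u < h2 v)%R ->
  (h1 u < h1 w)%R = (h2 u < h2 w)%R /\ (h1 v < h1 w)%R = (h2 v < h2 w)%R.
Proof.
move=> l1 l2 s1 s2; rewrite /= !inE negb_or andbT => /andP[/andP[uv uw] vw].
have [u1 v1 w1] : [/\ u \in A1, v \in A1 & w \in A1].
  by split; apply: s1; rewrite !inE eqxx ?orbT.
have [u2 v2 w2] : [/\ u \in A2, v \in A2 & w \in A2].
  by split; apply: s2; rewrite !inE eqxx ?orbT.
have := line_neq l1 u1 v1 uv; have := line_neq l1 u1 w1 uw.
have := line_neq l1 v1 w1 vw; have := line_neq l2 u2 v2 uv.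
have := line_neq l2 u2 w2 uw; have := line_neq l2 v2 w2 vw.
have := (proj2 l1) u v w u1 v1 w1; rewrite ((proj2 l2) u v w u2 v2 w2).
have := (proj2 l1) v u w v1 u1 w1; rewrite ((proj2 l2) v u w v2 u2 w2).
have := (proj2 l1) u w v u1 w1 v1; rewrite ((proj2 l2) u w v u2 w2 v2).
rewrite /between_in; move: (h1 u) (h1 v) (h1 w) (h2 u) (h2 v) (h2 w).
clear; lia.
Qed.

Lemma two_lines A y z c t : y \in A -> z \in A -> c \in A -> t \in A ->
  uniq [:: y; z; c; t] ->
  (forall T, T \in triangles_in A -> (y \in T) && (z \in T)) ->
  exists h1 h2, [/\ line_on (A :\ z) h1, line_on (A :\ y) h2, (h1 c < h1 y)%R &
    {in A :\ y :\ z &, forall d e, (h1 d < h1 e)%R = (h2 d < h2 e)%R}].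
Proof.
move=> yA zA cA tA; rewrite /= !inE !negb_or andbT.
move=> /and3P[/and3P[yz yc yt] /andP[zc zt] ct] star.
have noT x : x \in [set y; z] -> triangles_in (A :\ x) = set0.
  move=> xyz; apply/setP => T; rewrite in_set0; apply/negP; rewrite inE => /andP[Tt TA].
  have /star/andP[yT zT] : T \in triangles_in A.
    by rewrite inE Tt (subset_trans TA) // subD1set.
  have xT : x \in T by move: xyz; rewrite !inE => /orP[]/eqP->.
  by have := subsetP TA x xT; rewrite !inE eqxx.
have [h1 [l1 c_y]] : exists h1, line_on (A :\ z) h1 /\ (h1 c < h1 y)%R.
  have [h l] := line_exists sf (noT z (set22 _ _)).
  have := @line_neq _ _ c y l; rewrite !inE yz cA yA eq_sym zc eq_sym yc => /(_ isT isT isT) n.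
  case: (ltrP (h c) (h y)) => hh; first by exists h.
  by exists (fun x => - h x)%R; split; [exact: line_opp|rewrite ltrN2; order_lia].
(* A line comes without a direction. The pair [c], [t] fixes that of the second one, and
   [lines_agree] carries it to all common points. *)
have [h2 [l2 c_t]] : exists h2, line_on (A :\ y) h2 /\ (h1 c < h1 t)%R = (h2 c < h2 t)%R.
  have [h l] := line_exists sf (noT y (set21 _ _)).
  have := @line_neq _ _ c t l; rewrite !inE cA tA eq_sym yc eq_sym yt => /(_ isT isT ct) n.
  case: (boolP ((h1 c < h1 t)%R == (h c < h t)%R)) => [/eqP hh|hh]; first by exists h.
  exists (fun x => - h x)%R; split; first exact: line_opp.
  rewrite ltrN2; move: hh n; clear; lia.
exists h1, h2; split => //.
have m1 x : x \in A :\ y :\ z -> x \in A :\ z by rewrite !inE => /and3P[-> _ ->].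
have m2 x : x \in A :\ y :\ z -> x \in A :\ y by rewrite !inE => /and3P[_ -> ->].
have cC : c \in A :\ y :\ z by rewrite !inE cA eq_sym zc eq_sym yc.
have tC : t \in A :\ y :\ z by rewrite !inE tA eq_sym zt eq_sym yt.
have ag u v w : u \in A :\ y :\ z -> v \in A :\ y :\ z -> w \in A :\ y :\ z ->
    u != v -> u != w -> v != w -> (h1 u < h1 v)%R = (h2 u < h2 v)%R ->
    (h1 u < h1 w)%R = (h2 u < h2 w)%R /\ (h1 v < h1 w)%R = (h2 v < h2 w)%R.
  move=> uC vC wC uv uw vw; apply: (lines_agree l1 l2).
  - by move=> x; rewrite 3!inE => /or3P[] /eqP ->; apply: m1.
  - by move=> x; rewrite 3!inE => /or3P[] /eqP ->; apply: m2.
  - by rewrite /= !inE negb_or uv uw vw.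
have agc d : d \in A :\ y :\ z -> c != d -> (h1 c < h1 d)%R = (h2 c < h2 d)%R.
  move=> dC cd; case: (eqVneq t d) => [<-//|td].
  by case: (ag c t d).
have flip d e : d \in A :\ y :\ z -> e \in A :\ y :\ z -> d != e ->
    (h1 d < h1 e)%R = (h2 d < h2 e)%R -> (h1 e < h1 d)%R = (h2 e < h2 d)%R.
  move=> dC eC de.
  have := line_neq l1 (m1 _ dC) (m1 _ eC) de; have := line_neq l2 (m2 _ dC) (m2 _ eC) de.
  by clear; lia.
move=> d e dC eC; case: (eqVneq d e) => [->|de]; first by rewrite !ltxx.
case: (eqVneq c d) => [<-|cd]; first by case: (eqVneq c e) => [<-|ce]; [rewrite
  !ltxx|exact: agc].
case: (eqVneq c e) => [<-|ce]; first by apply: flip => //; exact: agc.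
by case: (ag c d e) => //; exact: agc.
Qed.

(** The triangle {y, z, t} excludes [opposite_sides], so the lines put [y] and [z] on the same side
    of [c], and [middle_place] applies to every other point. *)
Lemma pencil_middle A y z c t : y \in A -> z \in A -> c \in A -> t \in A ->
  uniq [:: y; z; c; t] ->
  (forall T, T \in triangles_in A -> (y \in T) && (z \in T)) ->
  betw y c z -> ~~ aligned y z t -> exists h, pencil_on A true h y z c.
Proof.
move=> yA zA cA tA U star ycz nt.
have [h1 [h2 [l1 l2 c_y ag]]] := two_lines yA zA cA tA U star.
move: U; rewrite /= !inE !negb_or andbT => /and3P[/and3P[yz yc yt] /andP[zc zt] ct].
have mC d : d \in A -> d != y -> d != z -> d \in A :\ y :\ z by rewrite !inE => -> -> ->.
have cC : c \in A :\ y :\ z by rewrite mC // eq_sym.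
have c_z : (h2 c < h2 z)%R.
  case: (ltrP (h2 c) (h2 z)) => // zc'; case/negP: nt.
  apply: (@opposite_sides A y z c t h1 h2) => //; rewrite 1?eq_sym //.
    by apply: ag => //; rewrite mC // eq_sym.
  have n : h2 z <> h2 c by apply: (line_neq l2) => //; rewrite !inE 1?eq_sym 1?yz 1?yc.
  by order_lia.
have pl d : d \in A -> d != y -> d != z -> d != c -> [/\ ~~ aligned y z d,
    (h1 d < h1 c)%R || (h1 y < h1 d)%R & (h2 d < h2 c)%R || (h2 z < h2 d)%R].
  move=> dA dy dz dc; apply: (@middle_place A y z c d h1 h2) => //; rewrite 1?eq_sym //.
  by apply: ag => //; rewrite mC // eq_sym.
(* On their lines [y] and [z] come immediately after [c], so they cut the common points at the same
   place and can share one coordinate. *)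
pose h x := if x == z then h1 y else h1 x.
have hC x : x != z -> h x = h1 x by rewrite /h => /negPf ->.
have hz : h z = h1 y by rewrite /h eqxx.
exists h; split => //.
- by rewrite /= !inE !negb_or yz yc zc.
- by apply: (line_homo l1) => u v; rewrite !inE => /andP[uz _] /andP[vz _]; rewrite !hC.
- have ord d : d \in A -> d != y -> d != z ->
    (h1 y < h1 d)%R = (h2 z < h2 d)%R /\ (h1 d < h1 y)%R = (h2 d < h2 z)%R.
    move=> dA dy dz; case: (eqVneq d c) => [->|dc].
      by rewrite c_y c_z !ltNge !ltW.
    case: (pl d dA dy dz dc) => _.
    have a1 := ag c d cC (mC _ dA dy dz); have a2 := ag d c (mC _ dA dy dz) cC.
    move: a1 a2 c_y c_z; clear; lia.
  apply: (line_homo l2) => u v; rewrite !inE => /andP[uy uA] /andP[vy vA].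
  case: (eqVneq u z) => [->|uz]; case: (eqVneq v z) => [->|vz].
  + by rewrite !ltxx.
  + by rewrite hz hC //; case: (ord v).
  + by rewrite hz hC //; case: (ord u).
  + by rewrite !hC // ag // mC.
- move=> d dA; rewrite /= !inE !negb_or andbT => /andP[/andP[_ yd] zd].
  case: (eqVneq d c) => [->|dc] /=.
    rewrite ycz; split => //; apply/negbTE/negP => b.
      by rewrite (betw_anti ycz b) eqxx in yc.
    by rewrite (betw_anti (betw_sym ycz) (betw_sym b)) eqxx in zc.
  case: (pl d dA) => //; rewrite 1?eq_sym // /aligned !negb_or => /and3P[n1 n2 n3] _ _.
  by split; apply/negbTE; rewrite // betwC.
- move=> d dA; rewrite /= !inE !negb_or andbT => /andP[/andP[_ yd] zd].
  rewrite hz !hC // 1?eq_sym //; split => //.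
  case: (eqVneq d c) => [->|dc]; first by rewrite lexx.
  case: (pl d dA) => //; rewrite 1?eq_sym // => _ /orP[/ltW->//|->]; by rewrite orbT.
Qed.

(** The triangle {y, z, t} excludes [same_side], so [z] is on the far side of [c], and
    [extreme_place] applies to every other point. *)
Lemma pencil_extreme A y z c t : y \in A -> z \in A -> c \in A -> t \in A ->
  uniq [:: y; z; c; t] ->
  (forall T, T \in triangles_in A -> (y \in T) && (z \in T)) ->
  betw c y z -> ~~ aligned y z t -> exists h, pencil_on A false h y z c.
Proof.
move=> yA zA cA tA U star cyz nt.
have [h1 [h2 [l1 l2 c_y ag]]] := two_lines yA zA cA tA U star.
move: U; rewrite /= !inE !negb_or andbT => /and3P[/and3P[yz yc yt] /andP[zc zt] ct].
have mC d : d \in A -> d != y -> d != z -> d \in A :\ y :\ z by rewrite !inE => -> -> ->.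
have cC : c \in A :\ y :\ z by rewrite mC // eq_sym.
have z_c : (h2 z < h2 c)%R.
  case: (ltrP (h2 z) (h2 c)) => // zc'; case/negP: nt.
  apply: (@same_side A y z c t h1 h2) => //; rewrite 1?eq_sym //.
    by apply: ag => //; rewrite mC // eq_sym.
  have n : h2 z <> h2 c by apply: (line_neq l2) => //; rewrite !inE 1?eq_sym 1?yz 1?yc.
  by order_lia.
have pl d : d \in A -> d != y -> d != z -> d != c -> [/\ ~~ aligned y z d,
    (h1 d < h1 c)%R & (h2 z < h2 d)%R].
  move=> dA dy dz dc; apply: (@extreme_place A y z c d h1 h2) => //; rewrite 1?eq_sym //.
  by apply: ag => //; rewrite mC // eq_sym.
(* By [extreme_place], [y] is the last point of its line and [z] the first of the other. After
   reversal [y] comes first and [z] must come after everything: [top] exceeds all the reversed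
   coordinates. *)
pose top := (\sum_(x in A) `|h1 x| + 1)%R.
have topP x : x \in A -> (- h1 x < top)%R.
  move=> xA; rewrite /top (bigD1 x) //=.
  have : (0 <= \sum_(i in A | i != x) `|h1 i|)%R by apply: sumr_ge0.
  by move: (\sum_(i in A | i != x) _)%R (h1 x); clear; lia.
pose h x := if x == z then top else (- h1 x)%R.
have hC x : x != z -> h x = (- h1 x)%R by rewrite /h => /negPf ->.
have hz : h z = top by rewrite /h eqxx.
exists h; split => //.
- by rewrite /= !inE !negb_or yz yc zc.
- by apply: (line_homo (line_opp l1)) => u v; rewrite !inE => /andP[uz _] /andP[vz _];
  rewrite !hC.
- have ord d : d \in A -> d != y -> d != z -> (h2 z < h2 d)%R.
    by move=> dA dy dz; case: (eqVneq d c) => [->//|dc]; case: (pl d).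
  apply: (line_homo (line_opp l2)) => u v; rewrite !inE => /andP[uy uA] /andP[vy vA].
  case: (eqVneq u z) => [->|uz]; case: (eqVneq v z) => [->|vz].
  + by rewrite !ltxx.
  + rewrite hz hC //; have := ord v vA vy vz; have := topP v vA; clear; lia.
  + rewrite hz hC //; have := ord u uA uy uz; have := topP u uA; clear; lia.
  + by rewrite !hC // !ltrN2 ag // mC.
- move=> d dA; rewrite /= !inE !negb_or andbT => /andP[/andP[_ yd] zd].
  case: (eqVneq d c) => [->|dc] /=.
    rewrite cyz; split => //; apply/negbTE/negP => b.
      by rewrite (betw_anti b cyz) eqxx in yc.
    by rewrite (betw_anti (betw_sym cyz) b) eqxx in yz.
  case: (pl d dA) => //; rewrite 1?eq_sym // /aligned !negb_or => /and3P[n1 n2 n3] _ _.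
  by split; apply/negbTE; rewrite // betwC.
- move=> d dA; rewrite /= !inE !negb_or andbT => /andP[/andP[_ yd] zd].
  have dc : (h1 d <= h1 c)%R.
    case: (eqVneq d c) => [->|dc]; first by rewrite lexx.
    by case: (pl d dA) => //; rewrite 1?eq_sym // => _ /ltW.
  have := topP d dA; rewrite hz !hC // 1?eq_sym //.
  by move: dc c_y; clear => ? ? ?; split; lia.
Qed.

(** The shape depends on which of [y], [z], [c] is in the middle. When it is [z], the roles of [y]
    and [z] are exchanged, hence the fresh names [y'], [z']. The second conclusion, uniqueness of
    [c], is what [not_one_triangle] needs. *)
Lemma pencil_exists A y z c t : y \in A -> z \in A -> c \in A -> t \in A ->
  y != z -> c \notin [set y; z] -> t \notin [set y; z] ->
  (forall T, T \in triangles_in A -> (y \in T) && (z \in T)) ->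
  aligned y z c -> ~~ aligned y z t ->
  (exists s h y' z', pencil_on A s h y' z' c) /\
  {in A :\ y :\ z, forall d, aligned y z d = (d == c)}.
Proof.
move=> yA zA cA tA yz cyz tyz star al nt.
move: cyz tyz; rewrite !inE !negb_or => /andP[cy cz] /andP[ty tz].
have ct : c != t by apply/eqP => E; rewrite -E al in nt.
have U : uniq [:: y; z; c; t] by rewrite /= !inE !negb_or yz ct ![_ == c]eq_sym ![_ ==
  t]eq_sym cy cz ty tz.
have U' : uniq [:: z; y; c; t].
  by rewrite /= !inE !negb_or (eq_sym z y) yz ct ![_ == c]eq_sym ![_ == t]eq_sym cy cz ty tz.
have star' T : T \in triangles_in A -> (z \in T) && (y \in T) by rewrite andbC; exact: star.
have unique s h u v : pencil_on A s h u v c -> {in A :\ u :\ v, forall d, aligned u v d =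
  (d == c)}.
  move=> p d; rewrite !inE => /and3P[dv du dA]; rewrite /aligned.
  have uv : u != v by have := pencil_uniq p; rewrite /= !inE negb_or => /andP[/andP[]].
  case: (pencil_betw p dA) => [|b1 b2 b3].
    by rewrite /= !inE !negb_or ![_ == d]eq_sym du dv uv.
  by rewrite (betwC v d u) b1 b2 b3 /=; case: (s); rewrite ?orbF.
case/or3P: al => h.
- have [|k p] := pencil_extreme zA yA cA tA U' star' (betw_sym h); first by rewrite alignedC.
  split; first by exists false, k, z, y.
  by move=> d dC; rewrite alignedC (unique _ _ _ _ p) // setDDl setUC -setDDl.
- have [k p] := pencil_middle yA zA cA tA U star (betw_sym h) nt.
  by split; [exists true, k, y, z|exact: unique p].
- have [k p] := pencil_extreme yA zA cA tA U star h nt.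
  by split; [exists false, k, y, z|exact: unique p].
Qed.

End TwoLines.

(** * Counting triangles *)

Section TwoTriangles.
Variable B : betweenness.
Variables o a b c d : B.
Hypotheses (U : uniq [:: o; a; b; c; d]).
Hypotheses (noab : ~~ aligned o a b) (nocd : ~~ aligned o c d).
Hypotheses (oac : aligned o a c) (oad : aligned o a d).
Hypotheses (obc : aligned o b c) (obd : aligned o b d).

Ltac start :=
  move: U; rewrite /= !inE !negb_or => /and5P[/and4P[? ? ? ?] /and3P[? ? ?] /andP[? ?] ? _]
    ? ? ? ?;
  move: noab nocd; rewrite /aligned !negb_or => /and3P[? ? ?] /and3P[? ? ?];
  move: oac oad obc obd; rewrite /aligned.

(** The four betweennesses state the order a, b, c, d. Each of the four mixed triples through [o]
    has three possible middle points; closing under (P2) and (P4) after each choice prunes the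
    search early. *)
Lemma separated_absurd : betw a b c -> betw b c d -> betw a b d -> betw a c d -> False.
Proof.
start.
case/or3P => ?; case/or3P => ?; try betw_absurd; case/or3P => ?; try betw_absurd; case/or3P
  => ?; betw_absurd.
Qed.

Lemma interleaved_absurd : betw a c b -> betw c b d -> betw a c d -> betw a b d -> False.
Proof.
start.
case/or3P => ?; case/or3P => ?; try betw_absurd; case/or3P => ?; try betw_absurd; case/or3P
  => ?; betw_absurd.
Qed.

Lemma nested_absurd : betw a c d -> betw c d b -> betw a c b -> betw a d b -> False.
Proof.
start.
case/or3P => ?; case/or3P => ?; try betw_absurd; case/or3P => ?; try betw_absurd; case/or3P
  => ?; betw_absurd.
Qed.
End TwoTriangles.

Section Counting.
Variable B : betweenness.
Hypothesis sf : square_free B.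
Implicit Types (a b c d x y z w v : B) (A T : {set B}).

Lemma triangles_in_sub A A' : A \subset A' -> triangles_in A \subset triangles_in A'.
Proof.
move=> s; apply/subsetP => T; rewrite !inE => /andP[-> h] /=; exact: subset_trans h s.
Qed.

Lemma triangles_inD1 A v : triangles_in (A :\ v) = [set T in triangles_in A | v \notin T].
Proof. by apply/setP => T; rewrite !inE subsetD1 andbA. Qed.

Lemma triangles_in_card A T : T \in triangles_in A -> #|T| = 3.
Proof. by rewrite inE => /andP[/triangle_card]. Qed.

Lemma triangles_in_subset A T : T \in triangles_in A -> T \subset A.
Proof. by rewrite inE => /andP[]. Qed.

Lemma set3_triangle_in A x y z : uniq [:: x; y; z] -> x \in A -> y \in A -> z \in A ->
  ([set x; y; z] \in triangles_in A) = ~~ aligned x y z.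
Proof.
move=> u xA yA zA; rewrite inE; apply/andP/idP => [[/triangleP[] //]|na].
split; first exact/triangleP.
by apply/subsetP => t; rewrite !inE -orbA => /or3P[] /eqP ->.
Qed.

(** Two points [c], [d] lie outside [T], and both are aligned with two vertices [y], [z] of [T],
    since {y, z, c} and {y, z, d} are not [T]. This contradicts the uniqueness of the point aligned
    with [y] and [z]. *)
Lemma not_one_triangle A T : 5 <= #|A| -> triangles_in A <> [set T].
Proof.
move=> A5 E.
have TA : T \in triangles_in A by rewrite E inE.
have [x [y [z [u TE]]]] := card3E (triangles_in_card TA).
have sTA := triangles_in_subset TA.
have inA v : v \in T -> v \in A := subsetP sTA v.
have [c [d [cA dA cd]]] : exists c d, [/\ c \in A :\: T, d \in A :\: T & c != d].
  by apply/card_gt1P; rewrite cardsD (setIidPr sTA) (triangles_in_card TA); lia.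
have na : ~~ aligned x y z.
  by rewrite -(set3_triangle_in (A := A)) -?TE //; apply: inA; rewrite TE !inE eqxx ?orbT.
have al e : e \in A :\: T -> aligned y z e.
  rewrite inE => /andP[eT eA]; apply/idPn => ne.
  have : [set y; z; e] \in triangles_in A.
    rewrite set3_triangle_in //; last 2 first.
    - by apply: inA; rewrite TE !inE eqxx ?orbT.
    - by apply: inA; rewrite TE !inE eqxx ?orbT.
    move: u eT; rewrite TE /= !inE !negb_or !andbT => /andP[_ ->] /andP[/andP[_ ey] ez].
    by rewrite eq_sym ey eq_sym ez.
  rewrite E inE => /eqP eTE; by rewrite -eTE !inE eqxx orbT in eT.
move: u; rewrite /= !inE negb_or andbT => /andP[/andP[xy xz] yz].
have mem e : e \in A :\: T -> e \in A :\ y :\ z /\ e \notin [set y; z].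
  by rewrite TE !inE !negb_or => /andP[/andP[/andP[_ -> ->] ->]].
have [cA' cyz] := mem c cA; have [dA' dyz] := mem d dA.
have [yA zA xA] : [/\ y \in A, z \in A & x \in A].
  by split; apply: inA; rewrite TE !inE eqxx ?orbT.
have star T' : T' \in triangles_in A -> (y \in T') && (z \in T').
  by rewrite E inE => /eqP ->; rewrite TE !inE !eqxx !orbT.
have xyz : x \notin [set y; z] by rewrite !inE negb_or xy xz.
have nyzx : ~~ aligned y z x by rewrite -alignedR.
have cA0 : c \in A by case/setDP: cA.
have [_ /(_ d dA')] := pencil_exists sf yA zA cA0 xA yz cyz xyz star (al c cA) nyzx.
by rewrite al // eq_sym (negPf cd).
Qed.

(* On the line through a, b, c, d the pairs {a, b} and {c, d} are separated,
   interleaved or nested; o cannot be placed in any of the three cases. *)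
Lemma two_triangles_absurd A h o a b c d : line_on A h ->
  a \in A -> b \in A -> c \in A -> d \in A -> uniq [:: o; a; b; c; d] ->
  ~~ aligned o a b -> ~~ aligned o c d ->
  aligned o a c -> aligned o a d -> aligned o b c -> aligned o b d -> False.
Proof.
move=> l.
have flip u v : aligned o v u = aligned o u v by rewrite alignedR alignedC -alignedR.
(* The hypotheses are symmetric under exchanging [a] and [b], [c] and [d], or the two pairs, so [a]
   may be taken lowest and [c] before [d]. The place of [b] then decides among the three cases. *)
wlog hab : a b / (h a <= h b)%R.
  move=> W aA bA cA dA U nab ncd ac ad bc bd.
  case: (lerP (h a) (h b)) => [|/ltW] hab; first exact: (W a b).
  apply: (W b a) => //; last by rewrite flip.
  by rewrite (perm_uniq (s2 := [:: o; a; b; c; d])) //; apply/permP => P /=; clear; lia.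
wlog hcd : c d / (h c <= h d)%R.
  move=> W aA bA cA dA U nab ncd ac ad bc bd.
  case: (lerP (h c) (h d)) => [|/ltW] hcd; first exact: (W c d).
  apply: (W d c) => //; last by rewrite flip.
  by rewrite (perm_uniq (s2 := [:: o; a; b; c; d])) //; apply/permP => P /=; clear; lia.
wlog hac : a b c d hab hcd / (h a <= h c)%R.
  move=> W aA bA cA dA U nab ncd ac ad bc bd.
  case: (lerP (h a) (h c)) => [|/ltW] hac; first exact: (W a b c d).
  apply: (W c d a b) => //; rewrite 1?flip //.
  by rewrite (perm_uniq (s2 := [:: o; a; b; c; d])) //; apply/permP => P /=; clear; lia.
move=> aA bA cA dA U nab ncd ac ad bc bd.
have bl p q r : p \in A -> q \in A -> r \in A ->
   (h p <= h q)%R -> (h q <= h r)%R -> betw p q r := line_betw l.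
have had := le_trans hac hcd.
case: (lerP (h b) (h c)) => [|/ltW] hbc.
  have hbd := le_trans hbc hcd.
  by apply: (separated_absurd U nab ncd) => //; apply: bl.
case: (lerP (h b) (h d)) => [|/ltW] hbd.
  by apply: (interleaved_absurd U nab ncd) => //; apply: bl.
by apply: (nested_absurd U nab ncd) => //; apply: bl.
Qed.

(** Two triangles among five points meet. If they met in a single point [o], the other four points
    would form a line, and every triple of [o] with one further vertex from each triangle would be
    collinear. *)
Lemma two_triangles_common A T1 T2 : #|A| = 5 -> T1 != T2 ->
  triangles_in A = [set T1; T2] -> 1 < #|T1 :&: T2|.
Proof.
move=> A5 T12 E; rewrite ltnNge; apply/negP => I1.
have T1A : T1 \in triangles_in A by rewrite E !inE eqxx.
have T2A : T2 \in triangles_in A by rewrite E !inE eqxx orbT.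
have c1 := triangles_in_card T1A; have c2 := triangles_in_card T2A.
have s1 := triangles_in_subset T1A; have s2 := triangles_in_subset T2A.
have U5 : #|T1 :|: T2| <= 5 by rewrite -A5; apply: subset_leq_card; rewrite subUset s1.
have/cards1P[o oE] : #|T1 :&: T2| == 1.
  by move: (cardsUI T1 T2) U5 I1; rewrite c1 c2; lia.
have /setIP[o1 o2] : o \in T1 :&: T2 by rewrite oE inE.
have d1 : #|T1 :\ o| == 2 by move: c1; rewrite (cardsD1 o) o1 add1n => -[->].
have d2 : #|T2 :\ o| == 2 by move: c2; rewrite (cardsD1 o) o2 add1n => -[->].
have /cards2P[a [b [ab abE]]] := d1; have /cards2P[c [d [cd cdE]]] := d2.
have T1E : T1 = [set o; a; b] by rewrite -(setD1K o1) abE setUA.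
have T2E : T2 = [set o; c; d] by rewrite -(setD1K o2) cdE setUA.
have meet x : x \in T1 -> x \in T2 -> x = o.
  by move=> x1 x2; apply/set1P; rewrite -oE inE x1.
have [oa ob] : o != a /\ o != b.
  have := setD11 o T1; rewrite abE !inE => /negbT; rewrite negb_or => /andP[-> ->] //.
have [oc od] : o != c /\ o != d.
  have := setD11 o T2; rewrite cdE !inE => /negbT; rewrite negb_or => /andP[-> ->] //.
have dif x y : x \in [set a; b] -> y \in [set c; d] -> x != y.
  move=> xab ycd; apply/eqP => xy; subst y.
  have : x = o by apply: meet; [rewrite T1E|rewrite T2E]; rewrite -setUA inE ?xab ?ycd orbT.
  by move=> xo; move: xab; rewrite xo !inE (negPf oa) (negPf ob).
have [ac ad bc bd] : [/\ a != c, a != d, b != c & b != d].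
  by split; apply: dif; rewrite !inE eqxx ?orbT.
have al x y w : x \in A -> y \in A -> w \in A -> uniq [:: x; y; w] ->
   [set x; y; w] != T1 -> [set x; y; w] != T2 -> aligned x y w.
  move=> xA yA wA u n1 n2; apply/idPn; rewrite -(@set3_triangle_in A) // E !inE.
  by rewrite (negPf n1) (negPf n2).
have inA x : x \in [set o; a; b; c; d] -> x \in A.
  rewrite !inE => h; have : (x \in T1) || (x \in T2).
    by rewrite T1E T2E !inE; move: h; rewrite -!orbA => /or4P[->|->|->|/orP[->|->]];
      rewrite ?orbT.
  by case/orP; [exact: (subsetP s1)|exact: (subsetP s2)].
have [oA [aA bA] [cA dA]] : [/\ o \in A, a \in A /\ b \in A & c \in A /\ d \in A].
  by split; [|split|split]; apply: inA; rewrite !inE eqxx ?orbT.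
have mixed x y : x \in [set a; b] -> y \in [set c; d] -> aligned o x y.
  move=> xab ycd; have xy := dif _ _ xab ycd.
  have xo : o != x by move: xab; rewrite !inE => /orP[] /eqP ->.
  have yo : o != y by move: ycd; rewrite !inE => /orP[] /eqP ->.
  apply: al; rewrite ?inA ?inE ?eqxx //.
  - by rewrite -!orbA; move: xab; rewrite !inE => /orP[] ->; rewrite ?orbT.
  - by rewrite -!orbA; move: ycd; rewrite !inE => /orP[] ->; rewrite ?orbT.
  - by rewrite /= !inE negb_or xo yo xy.
  - apply/eqP => e; have yT : y \in T1 by rewrite -e !inE eqxx orbT.
    have : y = o by apply: meet => //; rewrite T2E -setUA inE ycd orbT.
    by move=> e'; rewrite e' eqxx in yo.
  - apply/eqP => e; have xT : x \in T2 by rewrite -e !inE eqxx ?orbT.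
    have : x = o by apply: meet => //; rewrite T1E -setUA inE xab orbT.
    by move=> e'; rewrite e' eqxx in xo.
have noab : ~~ aligned o a b.
  by rewrite -(@set3_triangle_in A) -?T1E //= !inE negb_or oa ob ab.
have nocd : ~~ aligned o c d.
  by rewrite -(@set3_triangle_in A) -?T2E //= !inE negb_or oc od cd.
have [h l] : exists h, line_on (A :\ o) h.
  apply: line_exists => //; apply/setP => T; rewrite triangles_inD1 E !inE.
  by apply/andP => -[/orP[]/eqP->]; rewrite ?o1 ?o2.
have m x : x \in A -> o != x -> x \in A :\ o by rewrite !inE eq_sym => -> ->.
apply: (@two_triangles_absurd _ h o a b c d l); rewrite ?m //; try by apply: mixed; rewrite
  !inE eqxx ?orbT.
by rewrite /= !inE !negb_or oa ob oc od ab ac ad bc bd cd.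
Qed.

(* Induction on A: removing a point of some but not all triangles leaves exactly
   #|A| - 4 of them, so such a point lies in one triangle only. *)
Lemma sparse_sunflower A : 5 <= #|A| -> 0 < #|triangles_in A| <= #|A| - 3 ->
  #|triangles_in A| = #|A| - 3 /\
  exists y z, y != z /\ forall T, T \in triangles_in A -> (y \in T) && (z \in T).
Proof.
have [k] := ubnP #|A|; elim: k A => // k IH A Ak A5 tA.
have [A5'|A6] := leqP #|A| 5.
  have A5E : #|A| = 5 by lia.
  have [t1|t1] := leqP #|triangles_in A| 1.
    have /cards1P[T TE] : #|triangles_in A| == 1 by lia.
    by case: (not_one_triangle A5 TE).
  have /cards2P[T1 [T2 [T12 E]]] : #|triangles_in A| == 2 by lia.
  split; first lia.
  have [y [z [/setIP[y1 y2] /setIP[z1 z2] yz]]] := card_gt1P (two_triangles_common A5E T12 E).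
  by exists y, z; split=> // T; rewrite E !inE => /orP[] /eqP ->; rewrite ?y1 ?z1 ?y2 ?z2.
have ih v T : v \in A -> T \in triangles_in A -> v \notin T ->
    #|triangles_in (A :\ v)| <= #|A| - 4 ->
    #|triangles_in (A :\ v)| = #|A| - 4 /\
    exists y z, y != z /\ forall T, T \in triangles_in (A :\ v) -> (y \in T) && (z \in T).
  move=> vA TA vT le.
  have cA : #|A :\ v| = #|A| - 1 by rewrite (cardsD1 v A) vA; lia.
  have [] := IH (A :\ v); rewrite cA; [lia|lia| |].
    apply/andP; split; last lia.
    by apply/card_gt0P; exists T; rewrite triangles_inD1 inE TA.
  by move=> -> ?; split=> //; lia.
have lt v T : T \in triangles_in A -> v \in T -> #|triangles_in (A :\ v)| < #|triangles_in A|.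
  move=> TA vT; apply/proper_card/properP; split; first exact/triangles_in_sub/subD1set.
  by exists T; rewrite // triangles_inD1 inE TA vT.
have out T : T \in triangles_in A -> exists2 v, v \in A & v \notin T.
  move=> TA; apply/subsetPn; apply/negP => /subset_leq_card.
  by rewrite (triangles_in_card TA); lia.
have dif T T' : T \in triangles_in A -> T' \in triangles_in A -> T != T' ->
    exists v, [/\ v \in A, v \in T & v \notin T'].
  move=> TA TA' TT'.
  have /subsetPn[v vT vT'] : ~~ (T \subset T').
    apply: contra TT' => s; rewrite eqEcard s.
    by rewrite (triangles_in_card TA) (triangles_in_card TA') leqnn.
  by exists v; split=> //; apply: (subsetP (triangles_in_subset TA)).
(* With at most [#|A| - 4] triangles, [ih] yields exactly [#|A| - 4] after removing a point missed
   by some triangle. So there are two triangles; removing a point of one that misses the other loses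
   a triangle, yet by [ih] must again leave [#|A| - 4]. *)
have tk : #|triangles_in A| = #|A| - 3.
  case: (leqP (#|A| - 3) #|triangles_in A|) => t4; first by clear -tA t4; lia.
  have {}t4 : #|triangles_in A| <= #|A| - 4 by clear -t4; lia.
  have [T TA] : exists T, T \in triangles_in A by apply/card_gt0P; case/andP: tA.
  have [v vA vT] := out T TA.
  have le w : #|triangles_in (A :\ w)| <= #|triangles_in A|.
    exact/subset_leq_card/triangles_in_sub/subD1set.
  have [|e _] := ih v T vA TA vT; first exact: leq_trans (le v) t4.
  have t2 : 1 < #|triangles_in A| by have := le v; lia.
  have [T1 [T2 [T1A T2A T12]]] := card_gt1P t2.
  have [w [wA w1 w2]] := dif T1 T2 T1A T2A T12.
  have := lt w T1 T1A w1; have [|e' _] := ih w T2 wA T2A w2; last first.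
    by rewrite e' ltnNge t4.
  exact: leq_trans (le w) t4.
split=> //.
have one v T T' : v \in A -> T \in triangles_in A -> T' \in triangles_in A -> v \in T ->
    v \notin T' -> (forall T'', T'' \in triangles_in A -> v \in T'' -> T'' = T) /\
    exists y z, y != z /\ forall T, T \in triangles_in (A :\ v) -> (y \in T) && (z \in T).
  move=> vA TA TA' vT vT'; have l := lt v T TA vT.
  have [|e core] := ih v T' vA TA' vT'; first lia.
  split=> // T'' TA'' vT''; apply/eqP/idPn => n.
  have : #|triangles_in (A :\ v)| + 2 <= #|triangles_in A|.
    have I0 : triangles_in (A :\ v) :&: [set T; T''] = set0.
      apply/setP => x; rewrite triangles_inD1 in_setI in_set in_set2 in_set0.
      by apply/andP => -[/andP[_ vx]] /orP[]/eqP xE; rewrite xE ?vT ?vT'' in vx.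
    have := cardsUI (triangles_in (A :\ v)) [set T; T''].
    rewrite I0 cards0 addn0 cards2 eq_sym n => <-.
    apply: subset_leq_card; rewrite subUset triangles_in_sub ?subD1set //=.
    by apply/subsetP => x; rewrite in_set2 => /orP[]/eqP ->.
  by rewrite e tk; clear -A6; lia.
have [T [T' [TA TA' TT']]] : exists T T', [/\ T \in triangles_in A, T' \in triangles_in A &
  T != T'].
  by apply/card_gt1P; rewrite tk; clear -A6; lia.
have [v [vA vT vT']] := dif T T' TA TA' TT'.
have [oneT [y [z [yz core]]]] := one v T T' vA TA TA' vT vT'.
exists y, z; split=> // T'' TA''.
case: (eqVneq T'' T) => [-> {T'' TA''}|T''T]; last first.
  apply: core; rewrite triangles_inD1 inE TA''; apply/negP => vT''.
  by rewrite (oneT T'' TA'' vT'') eqxx in T''T.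
(* All triangles but [T] contain [y] and [z]; it remains to treat [T]. As [#|A| - 3] is at least 3,
   there is a third triangle [T2]. All triangles but [T'] contain some pair [y'], [z']. A point [q]
   of [T2] outside [T'] lies in no other triangle, so both pairs equal [T2] without [q]; hence [T],
   which contains [y'] and [z'], contains [y] and [z]. *)
have [T2 [T2A T2T T2T']] : exists T2, [/\ T2 \in triangles_in A, T2 != T & T2 != T'].
  have : 0 < #|triangles_in A :\: [set T; T']|.
    rewrite cardsD subn_gt0; apply: leq_ltn_trans (subset_leq_card (subsetIr _ _)) _.
    by rewrite cards2 TT' tk; clear -A6; lia.
  by case/card_gt0P => T2; rewrite in_setD in_set2 negb_or => /andP[/andP[? ?] ?]; exists T2.
have T'T2 : T' != T2 by rewrite eq_sym.
have T'T : T' != T by rewrite eq_sym.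
have [p [pA pT' pT2]] := dif T' T2 TA' T2A T'T2.
have [q [qA qT2 qT']] := dif T2 T' T2A TA' T2T'.
have [onep [y' [z' [y'z' core']]]] := one p T' T2 pA TA' T2A pT' pT2.
have [oneq _] := one q T2 T' qA T2A TA' qT2 qT'.
have core2 S : S \in triangles_in A -> S != T' -> (y' \in S) && (z' \in S).
  move=> SA ST'; apply: core'; rewrite triangles_inD1 inE SA; apply/negP => pS.
  by rewrite (onep S SA pS) eqxx in ST'.
have core1 S : S \in triangles_in A -> S != T -> (y \in S) && (z \in S).
  move=> SA ST; apply: core; rewrite triangles_inD1 inE SA; apply/negP => vS.
  by rewrite (oneT S SA vS) eqxx in ST.
have /andP[yT2 zT2] := core1 T2 T2A T2T.
have /andP[yT' zT'] := core1 T' TA' T'T.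
have /andP[y'T2 z'T2] := core2 T2 T2A T2T'.
have /andP[y'T z'T] := core2 T TA TT'.
have qT : q \notin T by apply/negP => /(oneq T TA) E; rewrite E eqxx in T2T.
have E1 : [set y; z] = T2 :\ q.
  apply/eqP; rewrite eqEcard subUset !sub1set !inE yT2 zT2 cards2 yz /=.
  have := triangles_in_card T2A; rewrite (cardsD1 q) qT2 add1n => -[->].
  by rewrite leqnn !andbT; apply/andP; split; apply: contraNneq qT' => <-.
have E2 : [set y'; z'] = T2 :\ q.
  apply/eqP; rewrite eqEcard subUset !sub1set !inE y'T2 z'T2 cards2 y'z' /=.
  have := triangles_in_card T2A; rewrite (cardsD1 q) qT2 add1n => -[->].
  by rewrite leqnn !andbT; apply/andP; split; apply: contraNneq qT => <-.
have sub : [set y; z] \subset T by rewrite E1 -E2 subUset !sub1set y'T.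
by move: sub; rewrite subUset !sub1set.
Qed.

End Counting.

Ltac split_ifs := repeat (case: ifP => ? //; try by exfalso; lia).

(** * Distances in the graphs *)

Section Graphs.
Variable R : realType.

(** A potential argument. Towards a fixed target, [D] drops by at most the weight along each edge,
    which bounds all paths from below. From every other vertex some edge attains equality with a
    positive weight, and following such edges gives a path of length [D]. *)
Lemma labelled_dist n (E : labels R) (n_gt0 : 0 < n) (wfE : wf_labels E)
    (cE : forall u v : 'I_n, connect (fun a b : 'I_n => E a b : bool) u v)
    (e : nat -> nat -> option nat) (D : nat -> nat -> nat) :
  (forall i j, E i j = omap (fun m => m%:R)%R (e i j)) ->
  (forall i, D i i = 0) ->
  (forall i j k m, i < n -> j < n -> k < n -> e i j = Some m -> D i k <= m + D j k) ->
  (forall i k, i < n -> k < n -> i != k ->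
     exists j m, [/\ j < n, 0 < m, e i j = Some m & D i k = m + D j k]) ->
  forall u v : 'I_n, dist (W := labelled_graph n_gt0 wfE cE) u v = (D u v)%:R%R.
Proof.
move=> eE D0 Dle Dst u v; set W := labelled_graph _ _ _.
have wE (x y : W) : weight x y = omap (fun m => m%:R)%R (e (x : 'I_n) (y : 'I_n)) by exact: eE.
apply/eqP; rewrite eq_le; apply/andP; split.
  have [k] := ubnP (D u v); elim: k u => // k IH u Dk.
  case: (eqVneq (u : nat) v) => [uv|uv].
    by rewrite (val_inj uv) D0 dist_refl.
  have [j [m [jn m0 ej Dj]]] := Dst u v (ltn_ord u) (ltn_ord v) uv.
  have ih := IH (Ordinal jn) ltac:(rewrite /=; lia).
  apply: (le_trans (dist_triangle (Ordinal jn : W) _ _)); rewrite Dj natrD lerD //.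
  have := @dist_le R W u [:: (Ordinal jn : W)].
  by rewrite /= /adj wE /= ej /= eE ej /= addr0; apply.
apply: le_dist => p; elim: p (u : W) => [|x p IH] y /=.
  by move=> _ _ ->; rewrite D0.
move=> /andP[yx px] /andP[_ up] lp.
move: yx; rewrite /adj wE; case exy: (e _ _) => [m|//] _ /=.
apply: (le_trans (y := (m + D (x : 'I_n) v)%:R%R)).
  by rewrite ler_nat; apply: Dle => //; apply: (ltn_ord (_ : 'I_n)).
by rewrite eE exy /= natrD lerD2l; apply: IH.
Qed.

Lemma labelled_betw n (E : labels R) (n_gt0 : 0 < n) (wfE : wf_labels E)
    (cE : forall u v : 'I_n, connect (fun a b : 'I_n => E a b : bool) u v)
    (D : nat -> nat -> nat) :
  (forall u v : 'I_n, dist (W := labelled_graph n_gt0 wfE cE) u v = (D u v)%:R%R) ->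
  forall u v w : 'I_n,
    @betw (graph_betweenness (labelled_graph n_gt0 wfE cE)) u v w =
      (D u w == D u v + D v w).
Proof.
by move=> dE u v w; rewrite /= /graph_betw !dE -natrD eqr_nat.
Qed.

Definition dist_nat (i j : nat) : nat := (i - j) + (j - i).

Definition cycle_dist i j := minn (dist_nat i j) (4 - dist_nat i j).

Lemma C4_betw (u v w : 'I_4) :
  @betw (graph_betweenness (C4 R)) u v w =
  (cycle_dist u w == cycle_dist u v + cycle_dist v w).
Proof.
apply: labelled_betw => {u v w}.
apply: (@labelled_dist _ _ _ _ _ (fun i j =>
  if [|| dist_nat i j == 3 | dist_nat i j == 1] && (i < 4) && (j < 4) then Some 1 else None)).
- move=> i j; rewrite /C4_labels /add_edge /set_edge /path_labels /dist_nat.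
  by do ![case: ifP => //=]; lia.
- by move=> i; rewrite /cycle_dist /dist_nat; lia.
- move=> i j k m ? ? ?; rewrite /cycle_dist /dist_nat.
  by case: ifP => // ? [<-]; lia.
- move=> [|[|[|[|//]]]] [|[|[|[|//]]]] _ _ // _.
  + by exists 1, 1.
  + by exists 1, 1.
  + by exists 3, 1.
  + by exists 0, 1.
  + by exists 2, 1.
  + by exists 0, 1.
  + by exists 1, 1.
  + by exists 1, 1.
  + by exists 3, 1.
  + by exists 0, 1.
  + by exists 2, 1.
  + by exists 2, 1.
Qed.

Lemma K3_betw (u v w : 'I_3) :
  @betw (graph_betweenness (K3 R)) u v w =
  ((u != w :> nat) == (u != v :> nat) + (v != w :> nat) :> nat).
Proof.
apply: (@labelled_betw _ _ _ _ _ (fun i j => i != j)) => {u v w}.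
apply: (@labelled_dist _ _ _ _ _ (fun i j => if i != j then Some 1 else None)
  (fun i j => i != j)).
- by move=> i j; rewrite /K3_labels; case: ifP.
- by move=> i; rewrite eqxx.
- by move=> i j k m _ _ _; case: ifP => // ? [<-]; case: (i != k); lia.
- by move=> i k _ k3 ik; exists k, 1; rewrite ik eqxx.
Qed.

(* The labels n - 1 and 0 (y and z in the three families) are at distance k; all
   other distances are measured on the line, through pos. *)
Definition model_dist n (pos : nat -> nat) k i j :=
  if (i == 0) && (j == n.-1) || (i == n.-1) && (j == 0) then k
  else dist_nat (pos i) (pos j).

(** The Lipschitz condition of [labelled_dist] across an edge at y or z. Only when the target is the
    other of these two does [k] replace a distance on the line; since both have the same place, the
    bounds on [m] and [k] suffice there. *)
Lemma model_dist_edge n pos k i j l m : pos 0 = pos n.-1 ->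
  (i == 0) || (i == n.-1) -> j != 0 -> j != n.-1 ->
  dist_nat (pos i) (pos j) <= m -> k <= m + dist_nat (pos i) (pos j) ->
  model_dist n pos k i l <= m + model_dist n pos k j l /\
  model_dist n pos k j l <= m + model_dist n pos k i l.
Proof.
move=> p0 iyz j0 jy dm km; rewrite /model_dist (negPf j0) (negPf jy) /=.
case: ifP => [il|_]; last by move: dm; rewrite /dist_nat; clear; lia.
have -> : pos l = pos i.
  by case/orP: il => /andP[/eqP-> /eqP->].
by move: dm km; rewrite /dist_nat; clear; lia.
Qed.

Lemma model_dist_inner n pos k i j l m : i != 0 -> i != n.-1 -> j != 0 -> j != n.-1 ->
  dist_nat (pos i) (pos j) <= m ->
  model_dist n pos k i l <= m + model_dist n pos k j l.
Proof.
rewrite /model_dist => /negPf-> /negPf-> /negPf-> /negPf-> /=.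
by rewrite /dist_nat; clear; lia.
Qed.

(** Places on the line. In Q, y and z are both at 0, just before x_1. In R they are both at k + 1,
    one after x_k and two before x_{k+1}, which is pushed to k + 3. In S, y is at 0 and z at n, two
    after x_{n-2}. The distance of y and z themselves is 2, 2 and n - 2. *)
Definition Q_pos n i := if i == n.-1 then 0 else i.
Definition R_pos n k i :=
  if (i == 0) || (i == n.-1) then k.+1 else if i <= k then i else i.+2.
Definition S_pos n i := if i == 0 then n else if i == n.-1 then 0 else i.

(** Isomorphism with one of the families, stated with natural-number distances on labels instead of
    real shortest paths. *)
Definition modelled (B : betweenness) n pos k := exists g : B -> 'I_n,
  bijective g /\ forall u v w, betw u v w =
   (model_dist n pos k (g u) (g w) ==
    model_dist n pos k (g u) (g v) + model_dist n pos k (g v) (g w)).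

Lemma iso_modelled (B : betweenness) n (E : labels R) (n_gt0 : 0 < n) (wfE : wf_labels E)
    (cE : forall u v : 'I_n, connect (fun a b : 'I_n => E a b : bool) u v) pos k :
  (forall u v : 'I_n, dist (W := labelled_graph n_gt0 wfE cE) u v =
     (model_dist n pos k u v)%:R%R) ->
  iso B (graph_betweenness (labelled_graph n_gt0 wfE cE)) <-> modelled B n pos k.
Proof.
move=> /labelled_betw bE; split=> -[f [fb fE]]; exists f; split=> // u v w.
  by rewrite -fE; apply: bE.
by rewrite fE; apply: bE.
Qed.

Section Families.
Variables (n : nat) (n_ge4 : 4 <= n).

Lemma Q_modelled B :
  iso B (graph_betweenness (Q_graph R n_ge4)) <-> modelled B n (Q_pos n) 2.
Proof.
apply: iso_modelled; apply: (@labelled_dist _ _ _ _ _ (fun i j =>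
  if ((i == 1) && (j \in [:: 0; n.-1])) || ((j == 1) && (i \in [:: 0; n.-1])) then Some 1
  else if [&& 1 <= i <= n - 2, 1 <= j <= n - 2 & (j == i.+1) || (i == j.+1)] then Some 1
    else None)).
- move=> i j; rewrite /Q_labels /add_edge /set_edge /path_labels !inE.
  by do ![case: ifP => //=]; lia.
- by move=> i; rewrite /model_dist /dist_nat; case: ifP; lia.
- move=> i j k m ? ? ?; rewrite /model_dist /dist_nat /Q_pos !inE.
  by do ![case: ifP => ?] => // -[<-]; lia.
- move=> i k i_n k_n ik.
  (* The witnesses are the second vertices of shortest paths from [i] to [k]: y and z lead only to
     x_1, and from x_i the label moves down or up towards the target. *)
  have [i1|i1] := boolP ((i == 0) || (i == n.-1)).
    exists 1, 1; rewrite /model_dist /dist_nat /Q_pos !inE; split=> //; first by lia.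
      by do ![case: ifP => //]; lia.
    by do ![case: ifP => //]; lia.
  have [k1|k1] := boolP ((i == 1) && ((k == 0) || (k == n.-1))).
    exists k, 1; rewrite /model_dist /dist_nat /Q_pos !inE; split=> //.
      by do ![case: ifP => //]; lia.
    by do ![case: ifP => //]; lia.
  have [ki|ki] := boolP ((k < i) || (k == n.-1)).
    exists i.-1, 1; rewrite /model_dist /dist_nat /Q_pos !inE; split=> //; first by lia.
      by do ![case: ifP => //]; lia.
    by do ![case: ifP => //]; lia.
  exists i.+1, 1; rewrite /model_dist /dist_nat /Q_pos !inE; split=> //; first by lia.
    by do ![case: ifP => //]; lia.
  by do ![case: ifP => //]; lia.
Qed.

(** The graph is a cycle of length 2n - 2. The edge {y, z} of weight n - 2 beats the rest of the
    cycle, of length n, but shortens no other distance: at best, from x_1 to z, there is a tie at n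
    - 1, and this tie puts y between x_1 and z. *)
Lemma S_modelled B :
  iso B (graph_betweenness (S_graph R n_ge4)) <-> modelled B n (S_pos n) (n - 2).
Proof.
apply: iso_modelled; apply: (@labelled_dist _ _ _ _ _ (fun i j =>
  if ((i == n.-1) && (j == 0)) || ((i == 0) && (j == n.-1)) then Some (n - 2)
  else if ((i == n - 2) && (j == 0)) || ((i == 0) && (j == n - 2)) then Some 2
  else if ((i == 1) && (j == n.-1)) || ((i == n.-1) && (j == 1)) then Some 1
  else if [&& 1 <= i <= n - 2, 1 <= j <= n - 2 & (j == i.+1) || (i == j.+1)] then Some 1
    else None)).
- move=> i j; rewrite /S_labels /add_edge /set_edge /path_labels.
  by do 4![case: ifP => //].
- by move=> i; rewrite /model_dist /dist_nat; case: ifP; lia.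
- move=> i j k m ? ? ?; move=> eij.
  have {eij} : (i = n.-1 /\ j = 0 \/ i = 0 /\ j = n.-1) /\ m = n - 2 \/
    (i = n - 2 /\ j = 0 \/ i = 0 /\ j = n - 2) /\ m = 2 \/
    (i = 1 /\ j = n.-1 \/ i = n.-1 /\ j = 1 \/
      1 <= i <= n - 2 /\ 1 <= j <= n - 2 /\ (j = i.+1 \/ i = j.+1)) /\ m = 1.
    move: eij; do 3![case: ifP => [E [<-]|_]; first by clear -E; lia].
    by case: ifP => // E [<-]; clear -E; lia.
  rewrite /model_dist /dist_nat /S_pos.
  by repeat (case: ifP => ?; try (by exfalso; lia)); lia.
- move=> i k i_n k_n ik.
  have [i0|i0] := boolP (i == 0).
    have [ky|ky] := boolP (k == n.-1).
      exists n.-1, (n - 2); rewrite /model_dist /dist_nat /S_pos; split; [lia|lia|by do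
        ![case: ifP => ?] => //; rewrite /=; try (congr Some); lia|by do ![case: ifP => ?];
          rewrite /=; lia].
    exists (n - 2), 2; rewrite /model_dist /dist_nat /S_pos; split; [lia|lia|by do ![case:
      ifP => ?] => //; rewrite /=; try (congr Some); lia|by do ![case: ifP => ?]; rewrite
        /=; lia].
  have [iy|iy] := boolP (i == n.-1).
    have [k0|k0] := boolP (k == 0).
      exists 0, (n - 2); rewrite /model_dist /dist_nat /S_pos; split; [lia|lia|by do
        ![case: ifP => ?] => //; rewrite /=; try (congr Some); lia|by do ![case: ifP => ?];
          rewrite /=; lia].
    exists 1, 1; rewrite /model_dist /dist_nat /S_pos; split; [lia|lia|by do ![case: ifP =>
      ?] => //; rewrite /=; try (congr Some); lia|by do ![case: ifP => ?]; rewrite /=; lia].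
  have [k0|k0] := boolP (k == 0).
    have [it|it] := boolP (i == n - 2).
      exists 0, 2; rewrite /model_dist /dist_nat /S_pos; split; [lia|lia|by do ![case: ifP
        => ?] => //; rewrite /=; try (congr Some); lia|by do ![case: ifP => ?]; rewrite /=;
          lia].
    exists i.+1, 1; rewrite /model_dist /dist_nat /S_pos; split; [lia|lia|by do ![case: ifP
      => ?] => //; rewrite /=; try (congr Some); lia|by do ![case: ifP => ?]; rewrite /=; lia].
  have [ky|ky] := boolP (k == n.-1).
    have [i1|i1] := boolP (i == 1).
      exists n.-1, 1; rewrite /model_dist /dist_nat /S_pos; split; [lia|lia|by do ![case:
        ifP => ?] => //; rewrite /=; try (congr Some); lia|by do ![case: ifP => ?]; rewrite
          /=; lia].
    exists i.-1, 1; rewrite /model_dist /dist_nat /S_pos; split; [lia|lia|by do ![case: ifP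
      => ?] => //; rewrite /=; try (congr Some); lia|by do ![case: ifP => ?]; rewrite /=; lia].
  have [ki|ki] := boolP (k < i).
    exists i.-1, 1; rewrite /model_dist /dist_nat /S_pos; split; [lia|lia|by do ![case: ifP
      => ?] => //; rewrite /=; try (congr Some); lia|by do ![case: ifP => ?]; rewrite /=; lia].
  exists i.+1, 1; rewrite /model_dist /dist_nat /S_pos; split; [lia|lia|by do ![case: ifP
    => ?] => //; rewrite /=; try (congr Some); lia|by do ![case: ifP => ?]; rewrite /=; lia].
Qed.

Definition R_weights r i j :=
  if ((i == n.-1) && (j == r.+1)) || ((i == r.+1) && (j == n.-1)) then Some 2
  else if ((i == 0) && (j == r.+1)) || ((i == r.+1) && (j == 0)) then Some 2
  else if ((i == n.-1) && (j == r)) || ((i == r) && (j == n.-1)) then Some 1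
  else if ((i == 0) && (j == r)) || ((i == r) && (j == 0)) then Some 1
  else if ((i == r) && (j == r.+1)) || ((i == r.+1) && (j == r)) then None
  else if [&& 1 <= i <= n - 2, 1 <= j <= n - 2 & (j == i.+1) || (i == j.+1)] then Some 1
    else None.

(** The deleted edge is replaced by two detours of length 1 + 2 through y and z, so the line is
    stretched by 2 after x_r. The vertices y and z are at distance 2 through x_r, against 4 through
    x_{r+1}. *)
Lemma R_modelled B r (r_I : 1 <= r <= n - 3) :
  iso B (graph_betweenness (R_graph R n_ge4 r_I)) <-> modelled B n (R_pos n r) 2.
Proof.
apply: iso_modelled; apply: (@labelled_dist _ _ _ _ _ (R_weights r)).
- move=> i j; rewrite /R_weights /R_labels /add_edge /del_edge /set_edge /path_labels.
  by do 6![case: ifP => //].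
- by move=> i; rewrite /model_dist /dist_nat; case: ifP; lia.
- move=> i j k m ? ? ?; move=> eij.
  have {eij} : (i = r.+1 /\ (j = 0 \/ j = n.-1) \/ j = r.+1 /\ (i = 0 \/ i = n.-1)) /\ m = 2 \/
    (i = r /\ (j = 0 \/ j = n.-1) \/ j = r /\ (i = 0 \/ i = n.-1)) /\ m = 1 \/
    (~ (i = r /\ j = r.+1 \/ i = r.+1 /\ j = r) /\
      1 <= i <= n - 2 /\ 1 <= j <= n - 2 /\ (j = i.+1 \/ i = j.+1)) /\ m = 1.
    move: eij; rewrite /R_weights; do 4![case: ifP => [E [<-]|_]; first by clear -E; lia].
    by case: ifP => // E; case: ifP => // E' [<-]; clear -E E'; lia.
  have R0 : R_pos n r 0 = r.+1 by rewrite /R_pos.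
  have Ry : R_pos n r n.-1 = r.+1 by rewrite /R_pos eqxx orbT.
  have Rr : R_pos n r r = r by rewrite /R_pos leqnn ifF //; clear -r_I n_ge4; lia.
  have Rr1 : R_pos n r r.+1 = r.+3 by rewrite /R_pos ltnn ifF //; clear -r_I n_ge4; lia.
  have p0 : R_pos n r 0 = R_pos n r n.-1 by rewrite R0 Ry.
  have edge u v d : (u == 0) || (u == n.-1) -> v = r /\ d = 1 \/ v = r.+1 /\ d = 2 ->
      model_dist n (R_pos n r) 2 u k <= d + model_dist n (R_pos n r) 2 v k /\
      model_dist n (R_pos n r) 2 v k <= d + model_dist n (R_pos n r) 2 u k.
    move=> uyz vd; have uE : R_pos n r u = r.+1 by case/orP: uyz => /eqP ->.
    apply: model_dist_edge => //; rewrite ?uE /dist_nat; clear -vd r_I n_ge4 Rr Rr1;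
      by case: vd => -[vE dE]; rewrite ?vE ?dE ?Rr ?Rr1; lia.
  move=> [[[[-> jE]|[-> iE]] ->]|[[[[-> jE]|[-> iE]] ->]|[[nr [i1 [j1 ij]]] ->]]].
  - by apply: (proj2 (edge j r.+1 2 _ _)); [case: jE => ->; rewrite eqxx ?orbT|right].
  - by apply: (proj1 (edge i r.+1 2 _ _)); [case: iE => ->; rewrite eqxx ?orbT|right].
  - by apply: (proj2 (edge j r 1 _ _)); [case: jE => ->; rewrite eqxx ?orbT|left].
  - by apply: (proj1 (edge i r 1 _ _)); [case: iE => ->; rewrite eqxx ?orbT|left].
  apply: model_dist_inner; try by clear -i1 j1; lia.
  rewrite /dist_nat /R_pos.
  have [-> ->] : (i == 0) || (i == n.-1) = false /\ (j == 0) || (j == n.-1) = false.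
    by clear -i1 j1; split; lia.
  by clear -nr ij; case: ifP => ?; case: ifP => ?; lia.
- move=> i k i_n k_n ik.
  have [iyz|iyz] := boolP ((i == 0) || (i == n.-1)).
    have [kr|kr] := boolP ((k <= r) || (k == n.-1)).
      exists r, 1; rewrite /R_weights /model_dist /dist_nat /R_pos; split; [lia|lia|by
        split_ifs|by split_ifs; rewrite /=; lia].
    exists r.+1, 2; rewrite /R_weights /model_dist /dist_nat /R_pos; split; [lia|lia|by
      split_ifs|by split_ifs; rewrite /=; lia].
  have weight_inner j : (j == 0) || (j == n.-1) = false -> j < n ->
      j = i.+1 /\ i <> r \/ i = j.+1 /\ i <> r.+1 -> R_weights r i j = Some 1.
    move=> jyz j_n ij; rewrite /R_weights; do 5 (rewrite ifF; last by lia).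
    by rewrite ifT //; lia.
  have pos_inner j : (j == 0) || (j == n.-1) = false ->
      R_pos n r j = if j <= r then j else j.+2.
    by rewrite /R_pos => ->.
  have dist_inner j l : (j == 0) || (j == n.-1) = false ->
      model_dist n (R_pos n r) 2 j l = dist_nat (R_pos n r j) (R_pos n r l).
    by move=> /norP[/negPf j0 /negPf jy]; rewrite /model_dist j0 jy.
  have [kyz|kyz] := boolP ((k == 0) || (k == n.-1)).
    have kE : R_pos n r k = r.+1 by rewrite /R_pos kyz.
    have [ir|ir] := boolP (i == r).
      exists k, 1; rewrite /R_weights /model_dist /dist_nat /R_pos; split; [lia|lia|by
        split_ifs|by split_ifs; rewrite /=; lia].
    have [ir1|ir1] := boolP (i == r.+1).
      exists k, 2; rewrite /R_weights /model_dist /dist_nat /R_pos; split; [lia|lia|by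
        split_ifs|by split_ifs; rewrite /=; lia].
    have [ir2|ir2] := boolP (i < r).
      have i1 : (i.+1 == 0) || (i.+1 == n.-1) = false by lia.
      exists i.+1, 1; rewrite weight_inner //; last by left; lia.
        split; [lia|by []|by []|].
        rewrite !dist_inner ?(negPf iyz) // kE !pos_inner ?(negPf iyz) //.
        by rewrite ltnW // ir2; clear -ir2; rewrite /dist_nat; lia.
      by clear -ir2 r_I n_ge4; lia.
    have i1 : (i.-1 == 0) || (i.-1 == n.-1) = false by lia.
    exists i.-1, 1; rewrite weight_inner //; [|by lia|by right; lia].
    split; [lia|by []|by []|].
    rewrite !dist_inner ?(negPf iyz) // kE !pos_inner ?(negPf iyz) //.
    by clear -ir ir1 ir2; rewrite /dist_nat; case: ifP => ?; case: ifP => ?; lia.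
  have [ki|ki] := boolP (k < i).
    (* From x_{r+1} to lower labels one has to pass through y or z; label 0, that is z, is
       chosen. *)
    have [ir|ir] := boolP (i == r.+1).
      exists 0, 2; rewrite /R_weights /model_dist /dist_nat /R_pos; split; [lia|lia|by
        split_ifs|by split_ifs; rewrite /=; lia].
    have i1 : (i.-1 == 0) || (i.-1 == n.-1) = false by lia.
    exists i.-1, 1; rewrite weight_inner //; [|by lia|by right; lia].
    split; [lia|by []|by []|].
    rewrite !dist_inner ?(negPf iyz) // !pos_inner ?(negPf iyz) ?(negPf kyz) //.
    by clear -ir ki; rewrite /dist_nat; do 3 case: ifP => ?; lia.
  have [ir|ir] := boolP (i == r).
    exists 0, 1; rewrite /R_weights /model_dist /dist_nat /R_pos; split; [lia|lia|by
      split_ifs|by split_ifs; rewrite /=; lia].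
  have i1 : (i.+1 == 0) || (i.+1 == n.-1) = false by lia.
  exists i.+1, 1; rewrite weight_inner //; [|by lia|by left; lia].
  split; [lia|by []|by []|].
  rewrite !dist_inner ?(negPf iyz) // !pos_inner ?(negPf iyz) ?(negPf kyz) //.
  by clear -ir ki ik; rewrite /dist_nat; do 3 case: ifP => ?; lia.
Qed.

End Families.
End Graphs.

(** * Regularity and co-size *)

(** In a square of distinct points, (P3) excludes every betweenness of distinct points beyond the
    four given ones and their reversals. Sending each point to its index in [:: a; b; c; d] is
    therefore an isomorphism with [C4]. *)
Lemma regular_square_free (R : realType) (B : betweenness) :
  regular R B <-> square_free B.
Proof.
split=> [reg a b c d u|sf Y Y0 Y4 [f [[g fK gK] fE]]]; last first.
  have i0 : 0 < 4 by []. have i1 : 1 < 4 by []. have i2 : 2 < 4 by []. have i3 : 3 < 4 by [].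
  pose v k : substructure Y0 := g k.
  have vE (i j k : 'I_4) : betw (val (v i)) (val (v j)) (val (v k)) =
      (cycle_dist i k == cycle_dist i j + cycle_dist j k).
    by rewrite -(C4_betw R) -(gK i) -(gK j) -(gK k) fE /v !gK.
  have vI (i j : 'I_4) : (val (v i) == val (v j)) = (i == j).
    by rewrite (inj_eq val_inj) /v (inj_eq (can_inj gK)).
  have := sf (val (v (Ordinal i0))) (val (v (Ordinal i1))) (val (v (Ordinal i2))) (val (v
    (Ordinal i3))).
  by rewrite /= !inE !vI /square !vE => /(_ isT).
apply/negP => /and4P[abc bcd cda dab].
pose s := [:: a; b; c; d]; pose Y := [set x in s].
have Y4 : #|Y| = 4 by rewrite cardsE (card_uniqP u).
have Y0 : 0 < #|Y| by rewrite Y4.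
apply: (reg Y Y0 Y4).
have idx (x : substructure Y0) : index (val x) s < 4.
  by rewrite -[4]/(size s) index_mem; have := valP x; rewrite inE.
pose f (x : substructure Y0) : graph_betweenness (C4 R) := Ordinal (idx x).
exists f; split.
  apply: inj_card_bij; last by rewrite card_ord card_sig -/Y Y4.
  move=> x y exy; apply: val_inj.
  have e : index (val x) s = index (val y) s := congr1 (@nat_of_ord 4) exy.
  have xs : val x \in s by have := valP x; rewrite inE.
  have ys : val y \in s by have := valP y; rewrite inE.
  by rewrite -(nth_index a xs) -(nth_index a ys) e.
have key i j k : i < 4 -> j < 4 -> k < 4 -> betw (nth a s i) (nth a s j) (nth a s k) =
    (cycle_dist i k == cycle_dist i j + cycle_dist j k).
  move: u abc bcd cda dab; rewrite /= !inE !negb_or.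
  move=> /and3P[/and3P[? ? ?] /andP[? ?] /andP[? _]] ? ? ? ?.
  have no x y : x != y -> ~~ betw x y x by apply: contra => /betw_id ->.
  case: i => [|[|[|[|//]]]] _; case: j => [|[|[|[|//]]]] _; case: k => [|[|[|[|//]]]] _;
    rewrite /= ?betw_refl ?betw_reflr // /cycle_dist /dist_nat /=;
    first [done | by rewrite betwC | by apply/negbTE/negP => ?; betw_absurd
      | by rewrite [LHS](_ : _ = false) //; apply/negbTE; apply: no; rewrite // eq_sym].
move=> x y z; have E (t : substructure Y0) : val t = nth a s (f t).
  by rewrite nth_index //; have := valP t; rewrite inE.
by rewrite C4_betw -key ?ltn_ord // -!E.
Qed.

(** * Squares and triangles in a pencil *)

Section Pencils.
Variable B : betweenness.
Implicit Types (a b c d x y z u v w : B) (A T : {set B}) (h : B -> int).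

Lemma line_triangle_free A h : line_on A h -> triangles_in A = set0.
Proof.
move=> [_ hb]; apply/setP => T; rewrite in_set0; apply/negP => TA.
have [x [y [z [u TE]]]] := card3E (triangles_in_card TA).
have sTA := triangles_in_subset TA; move: TA; rewrite TE set3_triangle_in //;
  try by apply: (subsetP sTA); rewrite TE !inE eqxx ?orbT.
have [xA yA zA] : [/\ x \in A, y \in A & z \in A].
  by split; apply: (subsetP sTA); rewrite TE !inE eqxx ?orbT.
rewrite /aligned !hb // /between_in; move: (h x) (h y) (h z); clear; lia.
Qed.

Lemma triangles_setT : triangles_in [set: B] = triangles B.
Proof. by apply/setP => T; rewrite inE subsetT andbT. Qed.

Lemma cosizeE : cosize B = #|triangles B|. Proof. by []. Qed.

Lemma line_square_free A h a b c d : line_on A h -> uniq [:: a; b; c; d] ->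
  {subset [:: a; b; c; d] <= A} -> ~~ square a b c d.
Proof.
move=> [hi hb]; rewrite /= !inE !negb_or => /and3P[/and3P[ab ac ad] /andP[bc bd] /andP[cd
  _]] sA.
have [aA bA cA dA] : [/\ a \in A, b \in A, c \in A & d \in A].
  by split; apply: sA; rewrite !inE eqxx ?orbT.
have neq x y : x \in A -> y \in A -> x != y -> h x <> h y.
  by move=> xA yA xy E; rewrite (hi x y xA yA E) eqxx in xy.
have := neq a b aA bA ab; have := neq a c aA cA ac; have := neq b d bA dA bd.
have := neq b c bA cA bc; have := neq c d cA dA cd; have := neq a d aA dA ad.
rewrite /square !hb // /between_in; move: (h a) (h b) (h c) (h d); clear; lia.
Qed.

Section Pencil.
Variables (s : bool) (h : B -> int) (y z c : B).
Hypothesis p : pencil_on [set: B] s h y z c.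

Let yz : y != z.
Proof. by have := pencil_uniq p; rewrite /= !inE negb_or => /andP[/andP[]]. Qed.
Let yc : y != c.
Proof. by have := pencil_uniq p; rewrite /= !inE negb_or => /andP[/andP[]]. Qed.
Let zc : z != c.
Proof. by have := pencil_uniq p; rewrite /= !inE negb_or => /and3P[]. Qed.

Lemma pencil_aligned d : uniq [:: y; z; d] -> aligned y z d = (d == c).
Proof.
move=> u; rewrite /aligned (betwC z d y).
by have [-> -> ->] := pencil_betw p (in_setT d) u; case: (s); rewrite ?orbF.
Qed.

(** A square that misses y or z would lie on a line. A square through both aligns y and z with each
    of its two other points, but only c is aligned with them. *)
Lemma pencil_square_free : square_free B.
Proof.
have line_free x e1 e2 e3 e4 : x \in [:: y; z] -> x \notin [:: e1; e2; e3; e4] ->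
    uniq [:: e1; e2; e3; e4] -> ~~ square e1 e2 e3 e4.
  rewrite [x \in _]inE mem_seq1 => /orP[/eqP->|/eqP->] n u.
    apply: line_square_free (pencil_line_z p) u _ => t ts.
    by rewrite !inE andbT; apply: contraNneq n => <-.
  apply: line_square_free (pencil_line_y p) u _ => t ts.
  by rewrite !inE andbT; apply: contraNneq n => <-.
have at_y a b d : uniq [:: y; a; b; d] -> ~~ square y a b d.
  move=> u; apply/negP => sq.
  have zs : z \in [:: y; a; b; d].
    by apply: contraTT sq => n; apply: line_free n u; rewrite !inE eqxx orbT.
  have one v w : uniq [:: y; z; v; w] -> aligned y z v -> aligned y z w -> False.
    rewrite /= !inE !negb_or => /and3P[/and3P[_ yv yw] /andP[zv zw] /andP[vw _]].
    rewrite !pencil_aligned /= ?inE ?negb_or ?yz ?yv ?yw ?zv ?zw //.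
    by move=> /eqP vE /eqP wE; rewrite vE wE eqxx in vw.
  move: sq u; rewrite /square => /and4P[e1 e2 e3 e4].
  move: zs; rewrite !inE eq_sym (negPf yz) /=.
  case/or3P => /eqP zE; move: e1 e2 e3 e4; rewrite -zE => e1 e2 e3 e4 u.
  - by apply: (one b d) => //; rewrite /aligned ?e1 ?e4 ?orbT.
  - apply: (one a d); first by rewrite (perm_uniq (s2 := [:: y; a; z; d])) //; apply/permP
    => P /=; clear; lia.
      by rewrite /aligned (betwC z a y) e1 orbT.
    by rewrite /aligned e3 orbT.
  - apply: (one a b); first by rewrite (perm_uniq (s2 := [:: y; a; b; z])) //; apply/permP
    => P /=; clear; lia.
      by rewrite /aligned (betwC a y z) e4 !orbT.
    by rewrite /aligned (betwC y z b) e3.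
move=> a b d e u; case: (boolP (y \in [:: a; b; d; e])) => [|n]; last first.
  by apply: line_free n u; rewrite inE eqxx.
have rot1 a1 a2 a3 a4 : square a1 a2 a3 a4 = square a2 a3 a4 a1.
  by rewrite /square; case: (betw a1 a2 a3); rewrite ?andbT ?andbF.
have urot a1 a2 a3 a4 : uniq [:: a1; a2; a3; a4] -> uniq [:: a2; a3; a4; a1].
  by rewrite -(rot_uniq 1).
rewrite !inE => /or4P[] /eqP yE; move: u; rewrite -yE => u.
- exact: at_y.
- by rewrite rot1; apply/at_y/urot.
- by rewrite 2!rot1; apply/at_y/urot/urot.
- by rewrite 3!rot1; apply/at_y/urot/urot/urot.
Qed.

Lemma pencil_cosize : cosize B = #|B| - 3.
Proof.
have -> : cosize B = #|[set [set y; z; d] | d in ~: [set y; z; c]]|.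
  rewrite cosizeE; congr #|pred_of_set _|; apply/setP => T; apply/idP/imsetP => [TB|[d]].
    have in_T x : x \in [set y; z] -> x \in T.
      move=> xyz; apply/idPn => xT.
      have : T \in triangles_in ([set: B] :\ x).
        by rewrite triangles_inD1 inE triangles_setT TB.
      case/set2P: xyz => ->.
        by rewrite (line_triangle_free (pencil_line_z p)) in_set0.
      by rewrite (line_triangle_free (pencil_line_y p)) in_set0.
    have yT := in_T y (set21 _ _); have zT := in_T z (set22 _ _).
    have : #|T :\ y :\ z| == 1.
      have := triangle_card TB; rewrite (cardsD1 y) yT (cardsD1 z (T :\ y)) in_setD1 zT
        (eq_sym z) yz.
      by rewrite !add1n => -[->].
    case/cards1P => d dE.
    have TE : T = [set y; z; d] by rewrite -setUA -dE !setD1K // in_setD1 zT eq_sym yz.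
    exists d => //; move: TB; rewrite TE => /triangleP[u]; rewrite pencil_aligned // => dc.
    move: u; rewrite /= !inE !negb_or dc !andbT => /andP[/andP[_ yd] zd].
    by rewrite eq_sym yd eq_sym zd.
  move=> dC ->; have [dy dz dc] : [/\ d != y, d != z & d != c].
    by move: dC; rewrite !inE !negb_or -andbA => /and3P.
  have u : uniq [:: y; z; d] by rewrite /= !inE negb_or yz eq_sym dy eq_sym dz.
  by apply/triangleP; rewrite pencil_aligned.
rewrite card_in_imset; last first.
  move=> d e; rewrite !inE !negb_or => /andP[/andP[dy dz] _] _ E.
  have : d \in [set y; z; e] by rewrite -E !inE eqxx orbT.
  by rewrite !inE (negPf dy) (negPf dz) /= => /eqP.
have := cardsC [set y; z; c]; rewrite -setUA cardsU1 cards2 !inE negb_or yz yc zc => <-.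
by rewrite addKn.
Qed.

End Pencil.
End Pencils.

(** * Pencils and the three families *)

Section FromModel.
Variables (B : betweenness) (n : nat) (n_ge4 : 4 <= n).

Lemma model_dist_line pos k i j : ~~ ((i == 0) && (j == n.-1)) ->
  ~~ ((i == n.-1) && (j == 0)) -> model_dist n pos k i j = dist_nat (pos i) (pos j).
Proof. by rewrite /model_dist => /negPf-> /negPf->. Qed.

Lemma modelled_card pos k : modelled B n pos k -> #|B| = n.
Proof. by case=> g [/bij_eq_card -> _]; rewrite card_ord. Qed.

(** [hz] is [pos] up to direction. It is kept apart because a pencil with [s = true] has c below y
    and z, whereas Q has them at the lower end of its line. *)
Lemma modelled_pencil pos k (hz : nat -> int) c s :
  (forall i j, dist_nat (pos i) (pos j) = absz (hz i - hz j)%R) ->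
  (forall i j, i < n -> j < n -> i != 0 -> j != 0 -> pos i = pos j -> i = j) ->
  (forall i j, i < n -> j < n -> i != n.-1 -> j != n.-1 -> pos i = pos j -> i = j) ->
  0 < c < n.-1 ->
  (forall d, 0 < d < n.-1 ->
    [/\ (k == dist_nat (pos n.-1) (pos d) + dist_nat (pos d) (pos 0)) = s && (d == c),
        (dist_nat (pos d) (pos 0) == dist_nat (pos d) (pos n.-1) + k) = ~~ s && (d == c)
      & (dist_nat (pos n.-1) (pos d) == k + dist_nat (pos 0) (pos d)) = false]) ->
  (forall d, 0 < d < n.-1 ->
    if s then [/\ hz n.-1 = hz 0, (hz c < hz n.-1)%R & (hz d <= hz c)%R || (hz n.-1 < hz d)%R]
    else [/\ (hz n.-1 < hz d)%R, (hz d < hz 0)%R & (hz c <= hz d)%R]) ->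
  modelled B n pos k ->
  exists h y z c, @pencil_on B [set: B] s h y z c.
Proof.
move=> dE inj0 injy c_n tri place [g [[f gK fK] gE]].
have n0 : 0 < n by lia.
have ny : n.-1 < n by lia.
have cn : c < n by lia.
pose y := f (Ordinal ny); pose z := f (Ordinal n0); pose c' := f (Ordinal cn).
have gy : g y = n.-1 :> nat by rewrite /y fK.
have gz : g z = 0 :> nat by rewrite /z fK.
have gc : g c' = c :> nat by rewrite /c' fK.
have gI u v : (g u == g v :> nat) = (u == v).
  by rewrite (inj_eq val_inj) (inj_eq (can_inj gK)).
have yz : y != z by rewrite -gI gy gz; lia.
have yc : y != c' by rewrite -gI gy gc; lia.
have zc : z != c' by rewrite -gI gz gc; lia.
have lin (A : {set B}) : (forall u v, u \in A -> v \in A -> ~~ ((g u == 0 :> nat) && (g v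
  == n.-1 :> nat))) ->
    (forall u v, u \in A -> v \in A -> pos (g u) = pos (g v) -> u = v) ->
    line_on A (fun x => hz (g x)).
  move=> noyz inj; split=> [u v uA vA e|u v w uA vA wA].
    by apply: inj => //; have := dE (g u) (g v); rewrite e /dist_nat; clear; lia.
  have nyz a b : a \in A -> b \in A -> ~~ ((g a == n.-1 :> nat) && (g b == 0 :> nat)).
    by move=> aA bA; rewrite andbC noyz.
  rewrite gE !model_dist_line ?noyz ?nyz // !dE /between_in.
  by move: (hz (g u)) (hz (g v)) (hz (g w)); clear; lia.
have inner d : uniq [:: y; z; d] -> 0 < g d < n.-1.
  rewrite /= !inE negb_or !andbT => /andP[/andP[_ yd] zd].
  move: yd zd; rewrite -!gI gy gz; have := ltn_ord (g d); clear; lia.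
exists (fun x => hz (g x)), y, z, c'; split; rewrite ?in_setT //.
- by rewrite /= !inE negb_or yz yc zc.
- apply: lin => [u v|u v]; rewrite !inE !andbT -!gI gz.
    by move=> /negPf-> _.
  by move=> u0 v0 e; apply: (can_inj gK); apply: val_inj; exact: inj0 (ltn_ord _) (ltn_ord
    _) u0 v0 e.
- apply: lin => [u v|u v]; rewrite !inE !andbT -!gI gy.
    by move=> _ /negPf->; rewrite andbF.
  by move=> u0 v0 e; apply: (can_inj gK); apply: val_inj; exact: injy (ltn_ord _) (ltn_ord
    _) u0 v0 e.
- move=> d _ u; have d_n := inner d u.
  have [t1 t2 t3] := tri _ d_n.
  have -> : (d == c') = (g d == c :> nat) by rewrite -gI gc.
  have m1 : model_dist n pos k (g y) (g z) = k.
    by rewrite /model_dist gy gz !eqxx orbT.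
  have m2 : model_dist n pos k (g z) (g y) = k.
    by rewrite /model_dist gy gz !eqxx.
  have m3 : model_dist n pos k (g y) (g d) = dist_nat (pos n.-1) (pos (g d)).
    by rewrite model_dist_line gy //; clear -d_n n_ge4; lia.
  have m4 : model_dist n pos k (g d) (g y) = dist_nat (pos (g d)) (pos n.-1).
    by rewrite model_dist_line gy //; clear -d_n n_ge4; lia.
  have m5 : model_dist n pos k (g z) (g d) = dist_nat (pos 0) (pos (g d)).
    by rewrite model_dist_line gz //; clear -d_n n_ge4; lia.
  have m6 : model_dist n pos k (g d) (g z) = dist_nat (pos (g d)) (pos 0).
    by rewrite model_dist_line gz //; clear -d_n n_ge4; lia.
  by rewrite !gE m1 m3 m4 m5 m6.
- by move=> d _ u; rewrite gy gz gc; apply: place; apply: inner.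
Qed.

Lemma Q_pencil : modelled B n (Q_pos n) 2 -> exists s h y z c, @pencil_on B [set: B] s h y z c.
Proof.
(* The point c is x_1, the common neighbour of y and z; the sign reverses the line so that x_1 comes
   below them. *)
move=> m; exists true; apply: (@modelled_pencil _ _ (fun i => - (Q_pos n i)%:Z)%R 1) m.
- by move=> i j; rewrite /dist_nat; lia.
- by move=> i j; rewrite /Q_pos; split_ifs; lia.
- by move=> i j; rewrite /Q_pos; split_ifs; lia.
- by lia.
- by move=> d d_n; rewrite /Q_pos /dist_nat eqxx; split_ifs; split; lia.
- by move=> d d_n; rewrite /Q_pos eqxx; split_ifs; split; lia.
Qed.

Lemma S_pencil : modelled B n (S_pos n) (n - 2) -> exists s h y z c, @pencil_on B [set: B]
  s h y z c.
Proof.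
move=> m; exists false; apply: (@modelled_pencil _ _ (fun i => (S_pos n i)%:Z)%R 1) m.
- by move=> i j; rewrite /dist_nat; lia.
- by move=> i j; rewrite /S_pos; split_ifs; lia.
- by move=> i j; rewrite /S_pos; split_ifs; lia.
- by lia.
- by move=> d d_n; rewrite /S_pos /dist_nat !eqxx; split_ifs; split; lia.
- by move=> d d_n; rewrite /S_pos !eqxx; split_ifs; split; lia.
Qed.

Lemma R_pencil r : 1 <= r <= n - 3 -> modelled B n (R_pos n r) 2 ->
  exists s h y z c, @pencil_on B [set: B] s h y z c.
Proof.
move=> r_n m; exists true; apply: (@modelled_pencil _ _ (fun i => (R_pos n r i)%:Z)%R r) m.
- by move=> i j; rewrite /dist_nat; lia.
- by move=> i j; rewrite /R_pos; split_ifs; lia.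
- by move=> i j; rewrite /R_pos; split_ifs; lia.
- by lia.
- move=> d d_n; have -> : R_pos n r d = if d <= r then d else d.+2 by rewrite /R_pos ifF
  //; lia.
  have -> : R_pos n r n.-1 = r.+1 by rewrite /R_pos eqxx orbT.
  rewrite [R_pos n r 0]/R_pos eqxx /dist_nat /=; case: ifP => ?; split; lia.
- move=> d d_n; have -> : R_pos n r d = if d <= r then d else d.+2 by rewrite /R_pos ifF
  //; lia.
  have -> : R_pos n r r = r by rewrite /R_pos leqnn ifF //; lia.
  have -> : R_pos n r n.-1 = r.+1 by rewrite /R_pos eqxx orbT.
  rewrite [R_pos n r 0]/R_pos eqxx /=; case: ifP => ?; split; lia.
Qed.

End FromModel.

(** * Labels from the order of the line *)

Section ToModel.
Variables (B : betweenness) (n : nat) (n_ge4 : 4 <= n) (Bn : #|B| = n).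
Variables (h : B -> int) (y z : B) (yz : y != z).
Hypotheses (ly : line_on ([set: B] :\ z) h) (lz : line_on ([set: B] :\ y) h).

(** A triple that misses y or z lies on a line, where only the order of the places counts; the
    remaining ones are y, z and some d, treated by the last hypothesis. The order is compared off z
    and off y separately, so nothing is asked of the places of y and z relative to each other. *)
Lemma modelled_line (g : B -> nat) (pos : nat -> nat) (k : nat) :
  injective g -> (forall x, g x < n) -> g y = n.-1 -> g z = 0 -> 0 < k ->
  (forall u v, u != z -> v != z -> (pos (g u) < pos (g v)) = (h u < h v)%R) ->
  (forall u v, u != y -> v != y -> (pos (g u) < pos (g v)) = (h u < h v)%R) ->
  (forall d, uniq [:: y; z; d] ->
    [/\ betw y d z = (k == dist_nat (pos n.-1) (pos (g d)) + dist_nat (pos (g d)) (pos 0)),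
        betw d y z = (dist_nat (pos (g d)) (pos 0) == dist_nat (pos (g d)) (pos n.-1) + k)
      & betw y z d = (dist_nat (pos n.-1) (pos (g d)) == k + dist_nat (pos 0) (pos (g d)))]) ->
  modelled B n pos k.
Proof.
move=> gI gn gy gz k0 oz oy tri.
exists (fun x => Ordinal (gn x)); split.
  by apply: inj_card_bij; rewrite ?card_ord ?Bn // => u v [] /gI.
pose D u v := model_dist n pos k (g u) (g v).
have n10 : (n.-1 == 0) = false by lia.
have gE u v : (g u == g v) = (u == v) by rewrite (inj_eq gI).
have DC u v : D u v = D v u.
  rewrite /D /model_dist; have -> : ((g u == 0) && (g v == n.-1) || (g u == n.-1) && (g v
    == 0)) =
    ((g v == 0) && (g u == n.-1) || (g v == n.-1) && (g u == 0)) by rewrite orbC andbC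
      (andbC (g u == 0)).
  by case: ifP => // _; rewrite /dist_nat addnC.
have Dyz : D y z = k by rewrite /D /model_dist gy gz !eqxx orbT.
have Dz u v : u != z -> v != z -> D u v = dist_nat (pos (g u)) (pos (g v)).
  by rewrite -!gE gz => uz vz; rewrite /D model_dist_line // ?(negPf uz) ?(negPf vz) // andbF.
have Dy u v : u != y -> v != y -> D u v = dist_nat (pos (g u)) (pos (g v)).
  by rewrite -!gE gy => uz vz; rewrite /D model_dist_line // ?(negPf uz) ?(negPf vz) // andbF.
have Dyd d : d != z -> D y d = dist_nat (pos n.-1) (pos (g d)) by move=> dz; rewrite Dz // gy.
have Dzd d : d != y -> D z d = dist_nat (pos 0) (pos (g d)) by move=> dz; rewrite Dy ?gz //
  eq_sym.
have D0 u : D u u = 0.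
  rewrite /D /model_dist; case: ifP => [|_]; last by rewrite /dist_nat; lia.
  by rewrite andbC orbb => /andP[/eqP e0 /eqP e1]; move: n10; rewrite -e0 e1 eqxx.
have neqz u v : u != z -> v != z -> u != v -> h u <> h v.
  by move=> uz vz uv; apply: (line_neq ly); rewrite ?inE ?uz ?vz.
have neqy u v : u != y -> v != y -> u != v -> h u <> h v.
  by move=> uz vz uv; apply: (line_neq lz); rewrite ?inE ?uz ?vz.
(* Positivity settles the degenerate triples u v u with u and v distinct, which are never
   betweennesses. *)
have D_gt0 u v : u != v -> 0 < D u v.
  move=> uv; have [uz|uz] := boolP ((u != z) && (v != z)).
    case/andP: uz => u1 v1; rewrite Dz // /dist_nat.
    by have := neqz u v u1 v1 uv; have := oz u v u1 v1; have := oz v u v1 u1; clear; lia.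
  have [uy|uy] := boolP ((u != y) && (v != y)).
    case/andP: uy => u1 v1; rewrite Dy // /dist_nat.
    by have := neqy u v u1 v1 uv; have := oy u v u1 v1; have := oy v u v1 u1; clear; lia.
  move: uz uy; rewrite !negb_and !negbK => /orP[] /eqP uz /orP[] /eqP uy.
  - by move: yz; rewrite -uz -uy eqxx.
  - by rewrite uz uy DC Dyz.
  - by rewrite uz uy Dyz.
  - by move: yz; rewrite -uz -uy eqxx.
pose G u v w := betw u v w = (D u w == D u v + D v w).
suff : forall u v w, G u v w by [].
have GC u v w : G u v w -> G w v u by rewrite /G betwC (DC w u) (DC w v) (DC v u) addnC.
have Gz u v w : u != z -> v != z -> w != z -> G u v w.
  move=> uz vz wz; rewrite /G (proj2 ly) ?inE ?uz ?vz ?wz // !Dz // /between_in /dist_nat.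
  have := oz u v uz vz; have := oz v u vz uz; have := oz u w uz wz; have := oz w u wz uz.
  have := oz v w vz wz; have := oz w v wz vz.
  move: (pos (g u)) (pos (g v)) (pos (g w)) (h u) (h v) (h w); clear; lia.
have Gy u v w : u != y -> v != y -> w != y -> G u v w.
  move=> uz vz wz; rewrite /G (proj2 lz) ?inE ?uz ?vz ?wz // !Dy // /between_in /dist_nat.
  have := oy u v uz vz; have := oy v u vz uz; have := oy u w uz wz; have := oy w u wz uz.
  have := oy v w vz wz; have := oy w v wz vz.
  move: (pos (g u)) (pos (g v)) (pos (g w)) (h u) (h v) (h w); clear; lia.
have Gt d : d != y -> d != z -> [/\ G y d z, G d y z & G y z d].
  move=> dy dz; have [|b1 b2 b3] := tri d; first by rewrite /= !inE negb_or yz eq_sym dy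
    eq_sym dz.
  rewrite /G Dyz b1 b2 b3 (DC d y) (DC d z) Dyd // Dzd //; split=> //.
    by rewrite /dist_nat; congr (_ == _ + _); rewrite addnC.
  by rewrite /dist_nat [X in X == _]addnC [X in _ == X + _]addnC.
move=> u v w.
case: (eqVneq u v) => [->|uv]; first by rewrite /G betw_refl D0 add0n eqxx.
case: (eqVneq v w) => [->|vw]; first by rewrite /G betw_reflr D0 addn0 eqxx.
case: (eqVneq u w) => [->|uw].
  rewrite /G D0; have := D_gt0 w v; rewrite eq_sym vw => /(_ isT) Dp.
  rewrite ltn_eqF ?addn_gt0 ?Dp //; apply/negbTE/negP => /betw_id e.
  by rewrite e eqxx in vw.
have [uz|uz] := eqVneq u z; have [uy|uy] := eqVneq u y.
- by move: yz; rewrite -uz -uy eqxx.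
- have [vy|vy] := eqVneq v y.
    rewrite uz vy; apply/GC; have [] := Gt w => //; rewrite -?vy -?uz eq_sym //.
  have [wy|wy] := eqVneq w y.
    by rewrite uz wy; apply/GC; have [] := Gt v => //; rewrite -?uz eq_sym.
  exact: Gy.
- have [vz|vz] := eqVneq v z.
    by rewrite uy vz; have [] := Gt w => //; rewrite -?vz -?uy eq_sym.
  have [wz|wz] := eqVneq w z.
    by rewrite uy wz; have [] := Gt v => //; rewrite -?uy eq_sym.
  exact: Gz.
have [vz|vz] := eqVneq v z.
  have [wy|wy] := eqVneq w y; last by apply: Gy => //; rewrite vz eq_sym.
  by rewrite vz wy; apply/GC; have [] := Gt u.
have [vy|vy] := eqVneq v y.
  have [wz|wz] := eqVneq w z; last exact: Gz.
  by rewrite vy wz; have [] := Gt u.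
have [wz|wz] := eqVneq w z; last exact: Gz.
by apply: Gy => //; rewrite wz eq_sym.
Qed.

Let C := [set: B] :\ y :\ z.
(** For x in [C] this is the index i for which x becomes x_i. The count includes x itself, so it
    runs from 1 to n - 2, like the labels. *)
Definition rank x := #|[set w in C | (h w <= h x)%R]|.

Let CP x : (x \in C) = (x != y) && (x != z).
Proof. by rewrite !inE andbT andbC. Qed.

Lemma card_inner : #|C| = n - 2.
Proof.
have := cardsT B; rewrite Bn (cardsD1 y) (cardsD1 z ([set: B] :\ y)) !inE (eq_sym z) yz /=.
by rewrite -/C; lia.
Qed.

Lemma rank_le x : rank x <= n - 2.
Proof. by rewrite -card_inner; apply: subset_leq_card; apply/subsetP => w; rewrite inE =>
  /andP[]. Qed.

Lemma rank_gt0 x : x \in C -> 0 < rank x.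
Proof. by move=> xC; apply/card_gt0P; exists x; rewrite inE xC /=. Qed.

Lemma rank_lt u v : v \in C -> (rank u < rank v) = (h u < h v)%R.
Proof.
move=> vC; case: (ltrP (h u) (h v)) => uv.
  apply: proper_card; rewrite properE; apply/andP; split.
    apply/subsetP => w; rewrite !in_set => /andP[-> /= wu].
    exact: le_trans wu (ltW uv).
  apply/subsetPn; exists v; first by rewrite inE vC /=.
  by rewrite inE vC /= -ltNge.
apply/negbTE; rewrite -leqNgt; apply: subset_leq_card; apply/subsetP => w.
by rewrite !in_set => /andP[-> /= wu]; exact: le_trans wu uv.
Qed.

Lemma rank_inj : {in C &, injective rank}.
Proof.
move=> u v uC vC e.
have uv := rank_lt u vC; have vu := rank_lt v uC; rewrite e ltnn in uv vu.
have e' : h u = h v by move: uv vu; clear; lia.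
move: uC vC; rewrite !CP => /andP[_ uz] /andP[_ vz].
by apply: (proj1 ly) e'; rewrite !inE ?uz ?vz.
Qed.

Definition rank_label x := if x == y then n.-1 else if x == z then 0 else rank x.

Lemma rank_label_inj : injective rank_label.
Proof.
move=> u v; rewrite /rank_label.
have rb x : x != y -> x != z -> 0 < rank x <= n - 2.
  by move=> xy xz; rewrite rank_le rank_gt0 ?CP ?xy.
case: (eqVneq u y) => [->|uy]; case: (eqVneq v y) => [->//|vy].
- by case: (eqVneq v z) => [_|vz]; [|have := rb v vy vz]; move: n_ge4; clear; lia.
- by case: (eqVneq u z) => [_|uz]; [|have := rb u uy uz]; move: n_ge4; clear; lia.
case: (eqVneq u z) => [->|uz]; case: (eqVneq v z) => [->//|vz].
- by have := rb v vy vz; move: n_ge4; clear; lia.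
- by have := rb u uy uz; move: n_ge4; clear; lia.
by apply: rank_inj; rewrite CP ?uy ?vy.
Qed.

Lemma rank_label_lt x : rank_label x < n.
Proof.
rewrite /rank_label; case: ifP => _; first by lia.
by case: ifP => _; [|have := rank_le x]; move: n_ge4; clear; lia.
Qed.

End ToModel.

Section Classification.
Variables (B : betweenness) (n : nat) (n_ge4 : 4 <= n) (Bn : #|B| = n).

Lemma rank_min (h : B -> int) y z c d : y != z -> line_on ([set: B] :\ z) h ->
  c \in [set: B] :\ y :\ z -> d \in [set: B] :\ y :\ z ->
  {in [set: B] :\ y :\ z, forall e, (h c <= h e)%R} -> (rank h y z d == 1) = (d == c).
Proof.
move=> yz ly cC dC cmin.
have c1 : rank h y z c = 1.
  apply/eqP/cards1P; exists c; apply/setP => e; rewrite in_set in_set1.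
  apply/andP/eqP => [[eC ec]|->//].
  have hec : h e = h c by have := cmin e eC; lia.
  by apply: (proj1 ly) hec; [move: eC|move: cC]; rewrite !inE => /and3P[-> _ _].
apply/eqP/eqP => [d1|->//]; apply: (rank_inj (y := y) (z := z) ly) => //.
by rewrite c1.
Qed.

Lemma pencil_modelled s (h : B -> int) y z c : pencil_on [set: B] s h y z c ->
  [\/ modelled B n (Q_pos n) 2,
      exists r, 1 <= r <= n - 3 /\ modelled B n (R_pos n r) 2
    | modelled B n (S_pos n) (n - 2)].
Proof.
move=> p; have ly := pencil_line_y p; have lz := pencil_line_z p.
have := pencil_uniq p; rewrite /= !inE negb_or andbT => /andP[/andP[yz yc] zc].
pose C := [set: B] :\ y :\ z.
have CP x : (x \in C) = (x != y) && (x != z) by rewrite !inE andbT andbC.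
have uC x : x \in C -> uniq [:: y; z; x].
  by rewrite CP /= !inE negb_or yz => /andP[xy xz]; rewrite eq_sym xy eq_sym xz.
have Cu x : uniq [:: y; z; x] -> x \in C.
  by rewrite CP /= !inE negb_or andbT => /andP[/andP[_ yx] zx]; rewrite eq_sym yx eq_sym zx.
have cC : c \in C by rewrite CP eq_sym yc eq_sym zc.
have place x : x \in C -> _ := fun xC => pencil_place p (in_setT x) (uC x xC).
have betwE x : x \in C -> _ := fun xC => pencil_betw p (in_setT x) (uC x xC).
have label k : [/\ rank_label n k y z y = n.-1, rank_label n k y z z = 0
    & forall x, x \in C -> rank_label n k y z x = rank k y z x].
  rewrite /rank_label !eqxx (eq_sym z) (negPf yz); split=> // x.
  by rewrite CP => /andP[/negPf-> /negPf->].
have rank_n k x : x \in C -> 0 < rank k y z x < n.-1.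
  move=> xC; have := rank_le n_ge4 Bn k yz x; have := @rank_gt0 B k y z x xC.
  by move: n_ge4; clear; lia.
have order k (pos : nat -> nat) (g : B -> nat) x :
    {in C &, forall u v, (pos (g u) < pos (g v)) = (k u < k v)%R} ->
    {in C, forall v, (pos (g x) < pos (g v)) = (k x < k v)%R /\
                     (pos (g v) < pos (g x)) = (k v < k x)%R} ->
    forall u v, (u == x) || (u \in C) -> (v == x) || (v \in C) ->
      (pos (g u) < pos (g v)) = (k u < k v :> int)%R.
  move=> inC atx u v /orP[/eqP->|uC'] /orP[/eqP->|vC'].
  - by rewrite ltnn ltxx.
  - by case: (atx v vC').
  - by case: (atx u uC').
  - exact: inC.
have nz u : u != z -> (u == y) || (u \in C) by rewrite CP => ->; rewrite andbT orbN.
have ny u : u != y -> (u == z) || (u \in C) by rewrite CP => ->; rewrite orbN.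
case: s p place betwE => p place betwE; last first.
  constructor 3; have [gy gz gC] := label h.
  have posC x : x \in C -> S_pos n (rank_label n h y z x) = rank h y z x.
    by move=> xC; rewrite gC // /S_pos; have := rank_n h x xC; split_ifs; lia.
  have posy : S_pos n n.-1 = 0 by rewrite /S_pos eqxx ifF //; lia.
  have posz : S_pos n 0 = n by [].
  have cmin : {in C, forall e, (h c <= h e)%R} by move=> e /place[].
  have inC : {in C &, forall u v, (S_pos n (rank_label n h y z u) < S_pos n (rank_label n h
    y z v)) = (h u < h v)%R}.
    by move=> u v uC' vC'; rewrite !posC // rank_lt.
  apply: (modelled_line n_ge4 Bn yz ly lz (g := rank_label n h y z)) => //.
  - exact: rank_label_inj.
  - exact: rank_label_lt.
  - by clear -n_ge4; lia.
  - move=> u v /nz uy /nz vy; apply: (order h (S_pos n)) uy vy => // w wC.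
    by rewrite gy posy posC //; have [+ _ _] := place w wC; have := rank_n h w wC; clear; lia.
  - move=> u v /ny uy /ny vy; apply: (order h (S_pos n)) uy vy => // w wC.
    by rewrite gz posz posC //; have [_ + _] := place w wC; have := rank_n h w wC; clear; lia.
  - move=> d /Cu dC; have [-> -> ->] := betwE d dC; rewrite -(rank_min yz ly cC dC cmin)
    posy posz posC //.
    by have := rank_n h d dC; move: (rank h y z d); rewrite /dist_nat; clear; split; lia.
(* A point above c is also above y and z, so their place is interior: this is R with r the rank of
   c, and r is at most n - 3 because of the point above. Without such a point y and z are at the end
   of the line, which gives Q. *)
case: (boolP [exists d in C, (h c < h d)%R]) => [/exists_inP[e eC ce]|/exists_inPn cmax].
  pose r := rank h y z c; have rn : 0 < r < n.-1 by apply: rank_n.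
  constructor 2; exists r; split.
    have := rank_n h e eC; have := rank_lt h c eC.
    by rewrite ce -/r; move: rn; clear; lia.
  have [gy gz gC] := label h.
  have posC x : x \in C -> R_pos n r (rank_label n h y z x) =
      if rank h y z x <= r then rank h y z x else (rank h y z x).+2.
    by move=> xC; rewrite gC // /R_pos ifF //; have := rank_n h x xC; clear; lia.
  have posy : R_pos n r n.-1 = r.+1 by rewrite /R_pos eqxx orbT.
  have posz : R_pos n r 0 = r.+1 by [].
  have inC : {in C &, forall u v, (R_pos n r (rank_label n h y z u) < R_pos n r (rank_label
    n h y z v)) = (h u < h v)%R}.
    move=> u v uC' vC'; rewrite !posC // -(@rank_lt B h y z u v) //.
    by clear; case: ifP => ?; case: ifP => ?; lia.
  have atyz x w : w \in C -> (h x = h y) -> R_pos n r (rank_label n h y z x) = r.+1 ->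
     (R_pos n r (rank_label n h y z x) < R_pos n r (rank_label n h y z w)) = (h x < h w)%R /\
     (R_pos n r (rank_label n h y z w) < R_pos n r (rank_label n h y z x)) = (h w < h x)%R.
    move=> wC -> ->; rewrite posC //.
    have := rank_lt h c wC; rewrite -/r => rw; have [_ + +] := place w wC.
    by move: rw; clear; case: ifP; split; lia.
  apply: (modelled_line n_ge4 Bn yz ly lz (g := rank_label n h y z)) => //.
  - exact: rank_label_inj.
  - exact: rank_label_lt.
  - move=> u v /nz uy /nz vy; apply: (order h (R_pos n r)) uy vy => // w wC.
    by apply: atyz; rewrite ?gy.
  - move=> u v /ny uy /ny vy; apply: (order h (R_pos n r)) uy vy => // w wC.
    by apply: atyz; rewrite ?gz //; have [-> _ _] := place c cC.
  - move=> d /Cu dC; have [-> -> ->] := betwE d dC; rewrite posy posz posC //.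
    have -> : (d == c) = (rank h y z d == r).
      by apply/eqP/eqP => [->//|]; apply: (rank_inj ly).
    by move: (rank h y z d); rewrite /dist_nat; clear => q; case: ifP => ?; split; lia.
(* In Q the vertices x_i are numbered from the end at y and z. Reversal makes c the lowest point of
   [C], hence x_1. *)
pose k x := (- h x)%R; have lky := line_opp ly; have lkz := line_opp lz.
constructor 1; have [gy gz gC] := label k.
have posC x : x \in C -> Q_pos n (rank_label n k y z x) = rank k y z x.
  by move=> xC; rewrite gC // /Q_pos ifF //; have := rank_n k x xC; clear; lia.
have posy : Q_pos n n.-1 = 0 by rewrite /Q_pos eqxx.
have posz : Q_pos n 0 = 0 by rewrite /Q_pos; case: ifP.
have cmin : {in C, forall e, (k c <= k e)%R}.
  by move=> e /cmax; rewrite /k; clear; lia.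
have inC : {in C &, forall u v, (Q_pos n (rank_label n k y z u) < Q_pos n (rank_label n k y
  z v)) = (k u < k v)%R}.
  by move=> u v uC' vC'; rewrite !posC // rank_lt.
have atyz x w : w \in C -> (h x = h y) -> Q_pos n (rank_label n k y z x) = 0 ->
   (Q_pos n (rank_label n k y z x) < Q_pos n (rank_label n k y z w)) = (k x < k w)%R /\
   (Q_pos n (rank_label n k y z w) < Q_pos n (rank_label n k y z x)) = (k w < k x)%R.
  move=> wC xy ->; rewrite posC //; have kx : k x = (- h y)%R by rewrite /k xy.
  have kw : k w = (- h w)%R by []; rewrite kx kw; have := cmax w wC; have := rank_n k w wC.
  by have [_ + +] := place w wC; clear; split; lia.
apply: (modelled_line n_ge4 Bn yz lky lkz (g := rank_label n k y z)) => //.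
- exact: rank_label_inj.
- exact: rank_label_lt.
- move=> u v /nz uy /nz vy; apply: (order k (Q_pos n)) uy vy => // w wC.
  by apply: atyz; rewrite ?gy.
- move=> u v /ny uy /ny vy; apply: (order k (Q_pos n)) uy vy => // w wC.
  by apply: atyz; rewrite ?gz //; have [-> _ _] := place c cC.
- move=> d /Cu dC; have [-> -> ->] := betwE d dC; rewrite -(rank_min yz lky cC dC cmin)
  posy posz posC //.
  by have := rank_n k d dC; move: (rank k y z d); rewrite /dist_nat; clear; split; lia.
Qed.

End Classification.

(** * Structures of minimum co-size *)

Section Minimum.
Variable B : betweenness.
Hypothesis sf : square_free B.

(** Up to order 4 the bound is at most 1. From order 5 on, a smaller positive co-size would satisfy
    the assumption of [sparse_sunflower] and contradict its conclusion. *)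
Lemma cosize_ge : 0 < cosize B -> #|B| - 3 <= cosize B.
Proof.
move=> m0; have [B4|B5] := leqP #|B| 4; first by clear -m0 B4; lia.
case: (leqP (#|B| - 3) (cosize B)) => // lt.
have := @sparse_sunflower B sf [set: B].
by rewrite triangles_setT cardsT -cosizeE m0 (ltnW lt) => /(_ B5 isT)[E _]; rewrite E ltnn
  in lt.
Qed.

Lemma min_pencil : 4 <= #|B| -> cosize B = #|B| - 3 ->
  exists s h y z c, @pencil_on B [set: B] s h y z c.
Proof.
move=> B4 mB.
suff [y [z [c [t [yz cyz tyz star [al nal]]]]]] : exists y z c t : B,
   [/\ y != z, c \notin [set y; z], t \notin [set y; z],
    forall T, T \in triangles B -> (y \in T) && (z \in T)
    & aligned y z c /\ ~~ aligned y z t].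
  have star' T : T \in triangles_in [set: B] -> (y \in T) && (z \in T).
    by rewrite triangles_setT; exact: star.
  have [[s [h [y' [z' p]]]] _] := pencil_exists sf (in_setT y) (in_setT z) (in_setT c)
    (in_setT t) yz cyz tyz star' al nal.
  by exists s, h, y', z', c.
have [T0 T0B] : exists T, T \in triangles B.
  by apply/card_gt0P; rewrite -cosizeE mB subn_gt0.
have [y [z [yz star]]] : exists y z : B, y != z /\
    forall T, T \in triangles B -> (y \in T) && (z \in T).
  (* At order 4, below the reach of [sparse_sunflower], there is a single triangle, and any two of
     its points serve. *)
  have [B4'|B5] := leqP #|B| 4.
    have /cards1P[T TE] : #|triangles B| == 1 by rewrite -cosizeE mB; move: B4 B4'; clear; lia.
    have TB : T \in triangles B by rewrite TE set11.
    have [x [y [z [u Exyz]]]] := card3E (triangle_card TB).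
    exists y, z; split; first by move: u; rewrite /= !inE andbT => /andP[].
    by move=> T'; rewrite TE => /set1P ->; rewrite Exyz !inE !eqxx !orbT.
  have [||_ [y [z [yz star]]]] := @sparse_sunflower B sf [set: B]; rewrite ?cardsT
    ?triangles_setT //.
    by rewrite -cosizeE mB leqnn andbT; move: B5; clear; lia.
  by exists y, z; split=> // T TB; apply: star; rewrite triangles_setT.
have third T : T \in triangles B -> exists t, t \notin [set y; z] /\ T = [set y; z; t].
  move=> TB; have /andP[yT zT] := star T TB.
  have : #|T :\ y :\ z| == 1.
    have := triangle_card TB; rewrite (cardsD1 y) yT (cardsD1 z (T :\ y)) in_setD1 zT
      (eq_sym z) yz.
    by rewrite !add1n => -[->].
  case/cards1P => t tE; exists t; split; last by rewrite -setUA -tE !setD1K // in_setD1 zT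
    eq_sym yz.
  have : t \in T :\ y :\ z by rewrite tE set11.
  by rewrite !in_setD1 !inE negb_or => /and3P[-> ->].
have [t [tyz tE]] := third T0 T0B.
have nal : ~~ aligned y z t by move: T0B; rewrite tE => /triangleP[].
suff [c [cyz al]] : exists c, c \notin [set y; z] /\ aligned y z c by exists y, z, c, t.
have [/existsP[c /andP[cyz al]]|/existsPn none] := boolP [exists c, (c \notin [set y; z])
  && aligned y z c].
  by exists c.
(* If no point were aligned with y and z, the n - 2 points off the pair would give as many distinct
   triangles, one more than there are. *)
have : #|~: [set y; z]| <= #|triangles B|.
  rewrite -(@card_in_imset _ _ (fun d => [set y; z; d])); last first.
    move=> d e; rewrite !in_setC !inE => dyz _ E.
    have : d \in [set y; z; e] by rewrite -E !inE eqxx orbT.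
    by rewrite !inE (negPf dyz) => /eqP.
  apply: subset_leq_card; apply/subsetP => _ /imsetP[d dC ->].
  apply/triangleP; move: (none d); rewrite negb_and negbK; move: dC; rewrite in_setC =>
    /[dup] dyz /negPf->.
  move=> /= na; split=> //; move: dyz; rewrite !inE negb_or => /andP[dy dz].
  by rewrite negb_or yz eq_sym dy eq_sym dz.
have := cardsC [set y; z]; rewrite cards2 yz -cosizeE mB; move: B4; clear; lia.
Qed.
End Minimum.

Lemma iso_refl (B : betweenness) : iso B B.
Proof. by exists id; split=> //; exists id. Qed.

(** * The value of tau and the extremal structures *)

Section Final.
Variable R : realType.

Lemma K3_iso (B : betweenness) :
  iso B (graph_betweenness (K3 R)) <-> #|B| = 3 /\ cosize B = 1.
Proof.
split=> [[f [fb fE]]|[B3]].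
  have B3 : #|B| = 3 by rewrite (bij_eq_card fb) card_ord.
  split=> //; rewrite cosizeE.
  have := cardsT B; rewrite B3 => /card3E[x [y [z [u E]]]].
  suff -> : triangles B = [set [set: B]] by rewrite cards1.
  have fI := bij_inj fb.
  have nb (a b c : B) : uniq [:: a; b; c] -> betw a b c = false.
    rewrite /= !inE negb_or andbT => /andP[/andP[ab ac] bc].
    have neq p q : p != q -> (f p != f q :> nat).
      by move=> pq; rewrite (inj_eq val_inj) (inj_eq fI).
    by rewrite -fE K3_betw !neq.
  apply/setP => T; rewrite in_set1; apply/idP/eqP => [TB|->].
    by apply/eqP; rewrite eqEcard subsetT cardsT B3 (triangle_card TB).
  have u1 : uniq [:: y; z; x] by rewrite -(rot_uniq 2); exact: u.
  have u2 : uniq [:: z; x; y] by rewrite -(rot_uniq 1); exact: u.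
  by rewrite E; apply/triangleP; split=> //; rewrite /aligned !nb.
rewrite cosizeE => /eqP/cards1P[T TE].
have TB : T \in triangles B by rewrite TE set11.
have setTE (U : {set B}) : #|U| = 3 -> U = T.
  move=> U3; have e (V : {set B}) : #|V| = 3 -> V = [set: B].
    by move=> V3; apply/eqP; rewrite eqEcard subsetT cardsT B3 V3.
  by rewrite (e U) // (e T) // triangle_card.
have nb (a b c : B) : uniq [:: a; b; c] -> ~~ betw a b c.
  move=> u; have : [set a; b; c] \in triangles B by rewrite (setTE _ (set3_uniq u erefl)).
  by case/triangleP => _; rewrite /aligned negb_or => /andP[].
pose f (x : B) : graph_betweenness (K3 R) := cast_ord B3 (enum_rank x).
have fI : injective f by move=> x y /cast_ord_inj/enum_rank_inj.
exists f; split; first by apply: inj_card_bij; rewrite // card_ord B3.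
move=> x y z; rewrite K3_betw.
have fE p q : (f p != f q :> nat) = (p != q) by rewrite (inj_eq val_inj) (inj_eq fI).
rewrite !fE.
case: (eqVneq x y) => [->|xy]; first by rewrite betw_refl; case: (y != z).
case: (eqVneq y z) => [<-|yz]; first by rewrite betw_reflr (negPf xy).
case: (eqVneq x z) => [<-|xz] /=.
  by apply/esym/negbTE/negP => /betw_id e; rewrite e eqxx in xy.
by apply/esym/negbTE/nb; rewrite /= !inE negb_or xy xz yz.
Qed.

(** The bridge for the rest: the three families of order n are exactly the pencils on n points, so
    co-size and regularity are read off from the pencil. *)
Lemma families_pencil (B : betweenness) n (n_ge4 : 4 <= n) :
  [\/ iso B (graph_betweenness (Q_graph R n_ge4)),
      exists r (r_I : 1 <= r <= n - 3), iso B (graph_betweenness (R_graph R n_ge4 r_I))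
    | iso B (graph_betweenness (S_graph R n_ge4))] <->
  #|B| = n /\ exists s h y z c, @pencil_on B [set: B] s h y z c.
Proof.
split=> [[/Q_modelled|[r [r_I /R_modelled]]|/S_modelled] m|[Bn [s [h [y [z [c p]]]]]]].
- by split; [exact: modelled_card m|exact: (Q_pencil n_ge4 m)].
- by split; [exact: modelled_card m|exact: (R_pencil n_ge4 r_I m)].
- by split; [exact: modelled_card m|exact: (S_pencil n_ge4 m)].
case: (pencil_modelled n_ge4 Bn p) => [m|[r [r_I m]]|m].
- by constructor 1; apply/Q_modelled.
- by constructor 2; exists r, r_I; apply/R_modelled.
- by constructor 3; apply/S_modelled.
Qed.

(** The value is attained by Q for n at least 4 and by K_3 for n = 3, which also excludes the
    default value 0 of [tau]. The lower bound 1 is built into [tau], and n - 3 is [cosize_ge]. *)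
Lemma tauE n : 3 <= n -> tau (regular R) n 0 = maxn 1 (n - 3).
Proof.
move=> n3.
have ex : has_structure (regular R) n (maxn 1 (n - 3)).
  have [n4|n4] := leqP 4 n.
    exists (graph_betweenness (Q_graph R n4)).
    have [|Bn [s [h [y [z [c p]]]]]] := proj1 (families_pencil (graph_betweenness (Q_graph
      R n4)) n4).
      by constructor 1; exact: iso_refl.
    split=> //; first by rewrite (pencil_cosize p) Bn; clear -n4; lia.
    by apply/regular_square_free/(pencil_square_free p).
  have -> : n = 3 by lia.
  exists (graph_betweenness (K3 R)).
  have [B3 m1] := proj1 (K3_iso _) (iso_refl (graph_betweenness (K3 R))).
  split=> //; apply/regular_square_free => a b c d u.
  have := max_card (mem [:: a; b; c; d]); rewrite (card_uniqP u) B3 //.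
rewrite /tau; case: pselect => [h|nh]; last first.
  by exfalso; apply: nh; exists (maxn 1 (n - 3)); apply/asboolP; rewrite leq_max.
case: ex_minnP => m /asboolP[m0 [B [Bn mB /regular_square_free sf]]] min.
apply/eqP; rewrite eqn_leq min ?geq_max ?m0 /=; last by apply/asboolP; rewrite leq_max.
by rewrite -Bn -mB cosize_ge // mB.
Qed.

End Final.

Theorem theorem2 (R : realType) (n : nat) (n_ge3 : 3 <= n) :
  tau (regular R) n 0 = maxn 1 (n - 3) /\
  forall B : betweenness, #|B| = n ->
    ((regular R B /\ cosize B = tau (regular R) n 0) <->
     [\/ exists n_ge4 : 4 <= n,
           iso B (graph_betweenness (Q_graph R n_ge4)),
         exists (n_ge4 : 4 <= n) (i : nat) (i_I : 1 <= i <= n - 3),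
           iso B (graph_betweenness (R_graph R n_ge4 i_I)),
         exists n_ge4 : 4 <= n,
           iso B (graph_betweenness (S_graph R n_ge4))
       | iso B (graph_betweenness (K3 R))]).
Proof.
split; first exact: tauE.
move=> B Bn; rewrite tauE //; split=> [[/regular_square_free sf mB]|fam].
  have /orP[n4|n4] : (4 <= n) || (n < 4) by rewrite leqNgt orNb.
    have p : exists s h y z c, @pencil_on B [set: B] s h y z c.
      by apply: min_pencil; rewrite ?Bn // mB; clear -n4; lia.
    have [q|[r [r_I q]]|q] := proj2 (families_pencil R B n4) (conj Bn p).
    - by constructor 1; exists n4.
    - by constructor 2; exists n4, r, r_I.
    - by constructor 3; exists n4.
  (* Here n = 3 and the minimum is 1; by [K3_iso] one triangle on three points determines the
     structure. *)
  constructor 4; apply/K3_iso; rewrite mB Bn; move: n_ge3 n4; clear; lia.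
have main n4 : [\/ iso B (graph_betweenness (Q_graph R n4)),
      exists r (r_I : 1 <= r <= n - 3), iso B (graph_betweenness (R_graph R n4 r_I))
    | iso B (graph_betweenness (S_graph R n4))] ->
    regular R B /\ cosize B = maxn 1 (n - 3).
  move=> /families_pencil[_ [s [h [y [z [c p]]]]]]; split.
    by apply/regular_square_free/(pencil_square_free p).
  by rewrite (pencil_cosize p) Bn; clear -n4; lia.
case: fam => [[n4 q]|[n4 [r [r_I q]]]|[n4 q]|/K3_iso[B3 m1]].
- by apply: (main n4); constructor 1.
- by apply: (main n4); constructor 2; exists r, r_I.
- by apply: (main n4); constructor 3.
split; last by rewrite m1 -Bn B3.
(* A structure of order 3 is regular because it has no four distinct points. *)
apply/regular_square_free => a b c d u.
by have := max_card (mem [:: a; b; c; d]); rewrite (card_uniqP u) B3.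
Qed.
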